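(* Let $n\ge1$ be an integer and let $0<\alpha<n$. For every $p$ with $\frac{2n}{\alpha}<p<\infty$ there exist a set $E\subseteq\mathbb{R}^n$ with $\mathcal{P}^{\alpha}(E)<\infty$ and a nonzero function $f\in L^p(\mathbb{R}^n)$ such that $\operatorname{supp}\widehat f\subseteq E$.
   Context: $\widehat f$ denotes the Fourier transform of $f$ in the sense of tempered distributions on $\mathbb{R}^n$, normalized on $L^1$ by $\widehat f(t)=(2\pi)^{-n/2}\int_{\mathbb{R}^n}f(x)e^{-ix\cdot t}\,dx$, and $\operatorname{supp}\widehat f$ is its (closed) distributional support. Packing measure. Let $0\le s<\infty$. For $0<\epsilon<1$ and $A\subseteq\mathbb{R}^n$, an $\epsilon$-packing of $A$ is a (countable) collection of pairwise disjoint open balls $\{B_{r_k}(x_k)\}_k$ with centres $x_k\in A$ and radii $0<r_k\le\epsilon/2$. Put $P^s_\epsilon(A)=\sup\sum_k(2r_k)^s$, the supremum over all $\epsilon$-packings of $A$; put $P^s_0(A)=\lim_{\epsilon\downarrow0}P^s_\epsilon(A)$, with $P^s_0(\emptyset)=0$. The packing $s$-measure of $A$ is $\mathcal{P}^s(A)=\inf\{\sum_{i=1}^\infty P^s_0(A_i): A=\bigcup_{i=1}^\infty A_i\}$. *)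

(* Defs.v *)
From HB Require Import structures.
From mathcomp Require Import all_boot all_order all_algebra.
From mathcomp Require Import all_classical all_reals all_analysis.
From mathcomp Require Import complex.

Set Implicit Arguments.
Unset Strict Implicit.
Unset Printing Implicit Defensive.

Import Order.TTheory GRing.Theory Num.Theory.
Import numFieldNormedType.Exports.

Local Open Scope classical_set_scope.
Local Open Scope ring_scope.
Local Open Scope complex_scope.

(* R^n is 'rV[R]_n. Its sigma-algebra is the product one, generated by the
   coordinates; as R is second countable, these are the Borel sets of R^n. *)
Section measurable_rV.
Context {R : realType} (n : nat).

Let coord (i : 'I_n) (x : 'rV[R]_n) : R := x ord0 i.

Let rV_set0 : g_sigma_preimage coord set0.
Proof. exact: sigma_algebra0. Qed.

Let rV_setC A : g_sigma_preimage coord A -> g_sigma_preimage coord (~` A).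
Proof. exact: sigma_algebraC. Qed.

Let rV_bigcup (F : _^nat) : (forall i, g_sigma_preimage coord (F i)) ->
  g_sigma_preimage coord (\bigcup_i (F i)).
Proof. exact: sigma_algebra_bigcup. Qed.

HB.instance Definition _ := @isMeasurable.Build
  (measure_tuple_display default_measure_display) 'rV[R]_n
  (g_sigma_preimage coord) rV_set0 rV_setC rV_bigcup.

Lemma measurable_coord_rV (i : 'I_n) :
  measurable_fun [set: 'rV[R]_n] (fun x : 'rV[R]_n => x ord0 i : R).
Proof.
move=> _ Y mY; rewrite setTI; apply: sub_sigma_algebra => /=.
rewrite -bigcup_seq/=; exists i => /=; first by rewrite mem_index_enum.
by exists Y => //; rewrite setTI.
Qed.

Lemma measurable_fun_rV d (T : measurableType d) (f : T -> 'rV[R]_n) :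
  (forall i, measurable_fun [set: T] (fun t => f t ord0 i : R)) ->
  measurable_fun [set: T] f.
Proof.
move=> mf.
have prefS : g_sigma_preimage (fun i => coord i \o f) `<=` measurable.
  apply: smallest_sub; first exact: sigma_algebra_measurable.
  rewrite -bigcup_seq; apply: bigcup_sub => i _ A [B mB <-].
  exact: mf.
move=> _ A mA; apply: prefS; rewrite g_sigma_preimage_comp.
by exists A.
Qed.

End measurable_rV.

Section lebesgue_rV.
Context {R : realType}.

Definition consr (n : nat) (z : R * 'rV[R]_n) : 'rV[R]_n.+1 :=
  \row_i if unlift ord0 i is Some j then z.2 ord0 j else z.1.

Lemma measurable_consr (n : nat) : measurable_fun [set: R * 'rV[R]_n] (@consr n).
Proof.
apply: measurable_fun_rV => i; under eq_fun do rewrite mxE.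
case: unliftP => [j _|_]; last exact: measurable_fst.
exact: (measurableT_comp (measurable_coord_rV j) measurable_snd).
Qed.

Section cons_measure.
Variables (n : nat) (m : {sigma_finite_measure set 'rV[R]_n -> \bar R}).

Definition cons_measure : set 'rV[R]_n.+1 -> \bar R :=
  pushforward (@lebesgue_measure R \x m)%E (@consr n).

Let mcons : measurable_fun setT (@consr n) := @measurable_consr n.

Let cons_measure0 : cons_measure set0 = 0%E.
Proof. exact: measure0. Qed.

Let cons_measure_ge0 A : (0 <= cons_measure A)%E.
Proof. exact: measure_ge0. Qed.

Let cons_measure_sigma_additive : semi_sigma_additive cons_measure.
Proof. exact: measure_semi_sigma_additive. Qed.

HB.instance Definition _ := isMeasure.Build _ _ _ cons_measure
  cons_measure0 cons_measure_ge0 cons_measure_sigma_additive.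

Let sigma_finite_cons_measure : sigma_finite [set: 'rV[R]_n.+1] cons_measure.
Proof.
have /sigma_finiteP[F [FT ndF Foo]] := sigma_finiteT (@lebesgue_measure R).
have /sigma_finiteP[G [GT ndG Goo]] := sigma_finiteT m.
pose uncons (x : 'rV[R]_n.+1) : R * 'rV[R]_n :=
  (x ord0 ord0, \row_i x ord0 (lift ord0 i)).
have unconsK z : uncons (consr z) = z.
  case: z => a v; rewrite /uncons !mxE unlift_none; congr pair.
  by apply/rowP => i; rewrite !mxE liftK.
have mu : measurable_fun [set: 'rV[R]_n.+1] uncons.
  apply/measurable_fun_pair; first exact: measurable_coord_rV.
  apply: measurable_fun_rV => i; under eq_fun do rewrite mxE.
  exact: measurable_coord_rV.
exists (fun k => uncons @^-1` (F k `*` G k)).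
  rewrite predeqE => x; split=> // _.
  have [i _ Fi] : (\bigcup_i F i) (uncons x).1 by rewrite -FT.
  have [j _ Gj] : (\bigcup_i G i) (uncons x).2 by rewrite -GT.
  exists (maxn i j) => //; split.
  - by move: Fi; exact/subsetPset/ndF/leq_maxl.
  - by move: Gj; exact/subsetPset/ndG/leq_maxr.
move=> k; have [mF Fk] := Foo k; have [mG Gk] := Goo k; split.
  rewrite -[X in measurable X]setTI; apply: mu => //; exact: measurableX.
have unconsE : uncons \o @consr n = id by apply/funext => z /=; exact: unconsK.
rewrite /cons_measure /pushforward -comp_preimage unconsE.
by rewrite preimage_id product_measure1E// lte_mul_pinfty// ge0_fin_numE.
Qed.

HB.instance Definition _ := Measure_isSigmaFinite.Build _ _ _
  cons_measure sigma_finite_cons_measure.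

End cons_measure.

(* n-dimensional Lebesgue measure, as an iterated product; 'rV[R]_0 is a
   point, of mass 1. *)
Fixpoint lebesgue_rV (n : nat) : {sigma_finite_measure set 'rV[R]_n -> \bar R} :=
  if n is k.+1 then cons_measure (lebesgue_rV k) else \d_(0 : 'rV[R]_0).

End lebesgue_rV.

Section fourier.
Context {R : realType} {n : nat}.
Local Notation V := 'rV[R]_n.
Local Notation mu := (@lebesgue_rV R n).

Definition dot (x y : V) : R := \sum_(i < n) x ord0 i * y ord0 i.

(* The library norm on 'rV[R]_n is the sup norm; balls here are Euclidean. *)
Definition enorm (x : V) : R := Num.sqrt (dot x x).
Definition eball (x : V) (r : R) : set V := [set y | enorm (y - x) < r].

Definition cmeasurable (f : V -> R[i]) : Prop :=
  measurable_fun [set: V] (fun x => complex.Re (f x) : R) /\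
  measurable_fun [set: V] (fun x => complex.Im (f x) : R).

Definition cintegral (f : V -> R[i]) : R[i] :=
  (\int[mu]_x complex.Re (f x)) +i* (\int[mu]_x complex.Im (f x)).

Definition memLp (p : R) (f : V -> R[i]) : Prop :=
  cmeasurable f /\
  ('N[mu]_p%:E [(fun x => (ComplexField.Normc.normc (f x))%:E)] < +oo)%E.

Definition cis (t : R) : R[i] := cos t +i* sin t.

Definition fourier (f : V -> R[i]) (t : V) : R[i] :=
  ((2 * pi) `^ (- (n%:R / 2)))%:C * cintegral (fun x => f x * cis (- dot x t)).

Definition partial (i : 'I_n) (g : V -> R) : V -> R :=
  fun x => 'D_(delta_mx ord0 i) g x.

Definition iter_partial (s : seq 'I_n) (g : V -> R) : V -> R :=
  foldr partial g s.

Definition smooth (g : V -> R) : Prop := forall s : seq 'I_n,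
  continuous (iter_partial s g) /\
  forall (i : 'I_n) (x : V), derivable (iter_partial s g) x (delta_mx ord0 i).

Definition csmooth (phi : V -> R[i]) : Prop :=
  smooth (fun x => complex.Re (phi x)) /\ smooth (fun x => complex.Im (phi x)).

Definition fsupp (phi : V -> R[i]) : set V := closure [set x | phi x != 0].

(* The test functions C_c^oo(U). *)
Definition test_fun (U : set V) (phi : V -> R[i]) : Prop :=
  [/\ csmooth phi, compact (fsupp phi) & fsupp phi `<=` U].

(* A distribution is represented by its action on functions, a total map of
   which only the values at Schwartz functions are meaningful. *)
Definition distribution_of (f : V -> R[i]) (phi : V -> R[i]) : R[i] :=
  cintegral (fun x => f x * phi x).

Definition fourier_dist (T : (V -> R[i]) -> R[i]) (phi : V -> R[i]) : R[i] :=
  T (fourier phi).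

Definition vanishes_on (T : (V -> R[i]) -> R[i]) (U : set V) : Prop :=
  forall phi, test_fun U phi -> T phi = 0.

Definition dist_supp (T : (V -> R[i]) -> R[i]) : set V :=
  ~` \bigcup_(U in [set U | open U /\ vanishes_on T U]) U.

End fourier.

Section packing.
Context {R : realType} {n : nat}.
Local Notation V := 'rV[R]_n.
Local Open Scope ereal_scope.

(* A packing is a family of balls indexed by a set D of natural numbers, hence
   finite (possibly empty) or countably infinite. *)
Definition packing (e : R) (A : set V) (D : set nat) (x : nat -> V)
    (r : nat -> R) : Prop :=
  (forall k, D k -> A (x k) /\ (0 < r k <= e / 2)%R) /\
  trivIset D (fun k => eball (x k) (r k)).

Definition packing_pre_eps (s e : R) (A : set V) : \bar R :=
  ereal_sup [set t | exists D x r, packing e A D x r /\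
    t = \esum_(k in D) ((2 * r k) `^ s)%:E].

(* On the empty set this is 0, since the only packing is the empty one. *)
Definition packing_pre (s : R) (A : set V) : \bar R :=
  lim (packing_pre_eps s e A @[e --> 0^'+]).

Definition packing_measure (s : R) (A : set V) : \bar R :=
  ereal_inf [set \sum_(0 <= i <oo) packing_pre s (F i) |
    F in [set F : nat -> set V | A = \bigcup_i F i]].

End packing.

(* Main.v *)
Require Import Defs.
From mathcomp Require Import all_boot all_order all_algebra.
From mathcomp Require Import all_classical all_reals all_analysis.
From mathcomp Require Import measurable_realfun complex lra ring.

Import Order.TTheory GRing.Theory Num.Theory.
Import numFieldNormedType.Exports.

Set Implicit Arguments.
Unset Strict Implicit.
Unset Printing Implicit Defensive.

Local Open Scope classical_set_scope.
Local Open Scope ring_scope.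

(** The function is the limit of the smoothly truncated trigonometric sums
<<
  f_k(x) = T^-k * W(N^-k x) * sum over d in D_k of exp(i d.x),
>>
    where D_k is a set of T^k frequencies and W is the product over the
    coordinates of the Fejer kernel (1 - cos s) / s^2. The Fourier transform of
    W(N^-k x) lives in the cube of half-side N^-k, so that of f_k lives in the
    union of the cubes of half-side N^-k around D_k ([approx_spectrum]). The
    next set D_{k+1} replaces each d by T points d + N^-(k+1) j, where each
    coordinate of j is a difference of two numbers in 0, ..., N - 1.

    The Fejer kernel refines itself: the mean of exp(i N^-(k+1) j.x) over all
    these j, multiplied by W(N^-(k+1) x), is exactly W(N^-k x)
    ([prod_fejer_refine]). If the T^(k+1) values of j were random and
    independent, f_{k+1} - f_k would thus be T^-(k+1) W(N^-(k+1) x) times a sum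
    of T^(k+1) independent centred terms of modulus at most 2, which has size
    about T^(-(k+1)/2). The method of conditional expectations makes such a
    choice: the j are fixed one after the other so that the integral of an
    exponential potential of the partial sum never exceeds its mean
    ([greedy_selection]). As the mass of W(N^-(k+1) x) is N^(n(k+1)) up to a
    constant, the p-th power of the L^p norm of f_{k+1} - f_k is at most
    C (N^n T^(-p/2))^(k+1) ([refine_step]), and the f_k are bounded in L^p as
    soon as N^(2n/p) < T. By Fatou's lemma so is their pointwise limit f
    ([memLp_limit_fun]). Near the origin all the phases d.x are at most 1, so
    the real parts of the f_k stay away from 0 there and f is not zero
    ([limit_fun_neq0]).

    Let E be the set of the points that belong to the cubes of every level
    ([limit_set]). The Fourier transform of a test function is dominated by a
    constant times the product of the 1 / (1 + t_i^2) ([amp_decay]), so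
    dominated convergence transfers the vanishing outside of the cubes from the
    f_k to f, and E contains the support of the Fourier transform of f
    ([dist_supp_limit_fun]).

    The balls of a packing of E whose radius is comparable to N^-k have their
    centres in distinct cubes of level k, so there are at most T^k of them and
    they contribute at most a constant times (T N^-alpha)^k. The packing
    measure of E is therefore finite if T < N^alpha ([packing_measure_lty]).
    Since 2n/p < alpha, an integer T lies strictly between N^(2n/p) and N^alpha
    once N is large ([exists_parameters]). *)

(** * Measure and integration on R^n *)

Lemma measurable_funEFin d (T : measurableType d) (R : realType) (f : T -> R) :
  measurable_fun setT f -> measurable_fun setT (fun x => (f x)%:E).
Proof. by move=> mf; exact/measurable_EFinP. Qed.

Section rV_measure.
Context {R : realType}.
Implicit Types n : nat.

(** An open set is a countable union of boxes with rational centres and radii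
    1 / m, and these boxes are measurable for the product sigma-algebra. *)
Lemma open_measurable_rV n (U : set 'rV[R]_n) : open U -> measurable U.
Proof.
move=> oU.
pose box (q : 'rV[rat]_n * nat) : set 'rV[R]_n :=
  \bigcap_(i in [set: 'I_n])
    [set x | ball (ratr (q.1 ord0 i) : R) (q.2.+1%:R^-1) (x ord0 i)].
have mbox q : measurable (box q).
  apply: fin_bigcap_measurable; first exact: finite_finset.
  move=> i _; have := measurable_coord_rV i (n := n) (R := R).
  have mb : measurable (ball (ratr (q.1 ord0 i) : R) q.2.+1%:R^-1).
    by apply: open_measurable; exact: ball_open.
  move=> /(_ measurableT _ mb).
  by rewrite setTI.
have -> : U = \bigcup_(q in [set q | box q `<=` U]) box q.
  apply/seteqP; split=> [x Ux|x [q qU qx]]; last exact: qU.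
  have /nbhs_ballP[e /= e0 eU] : nbhs x U by exact: open_nbhs_nbhs.
  have e20 : 0 < e / 2 by rewrite divr_gt0.
  have [m _ /(_ m (leqnn m)) /= me] := near_infty_natSinv_lt (PosNum e20).
  have m0 : 0 < m.+1%:R^-1 :> R by rewrite invr_gt0.
  have qx i : exists q : rat, `|ratr q - x ord0 i| < m.+1%:R^-1.
    have /rat_in_itvoo[q] : x ord0 i - m.+1%:R^-1 < x ord0 i + m.+1%:R^-1.
      by rewrite ltrD2l gtrN.
    by rewrite in_itv/= -ltr_distl; exists q.
  have [q qP] := choice qx.
  exists (\row_i q i, m).
    move=> y /= yb; apply: eU; split => // i j; rewrite (ord1 i).
    have /= := yb j I; rewrite /ball/= mxE => h1.
    rewrite (le_lt_trans (ler_distD (ratr (q j)) _ _))// (splitr e) ltrD//.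
      by rewrite distrC (lt_trans (qP j)).
    by rewrite (lt_trans h1).
  by move=> i _ /=; rewrite /ball/= mxE; exact: qP.
rewrite bigcup_mkcond; apply: countable_bigcupT_measurable => // q.
by case: ifPn => // _; exact: measurable0.
Qed.

Lemma continuous_measurable_rV n (f : 'rV[R]_n -> R) :
  continuous f -> measurable_fun setT f.
Proof.
move=> /continuousP cf; apply: (measurability _ (RGenOpens.measurableE R)).
move=> _ [_ [a [b ->] <-]]; rewrite setTI; apply: open_measurable_rV.
exact/cf/interval_open.
Qed.

Lemma consr0 n (z : R * 'rV[R]_n) : consr z ord0 ord0 = z.1.
Proof. by rewrite mxE unlift_none. Qed.

Lemma consrS n (z : R * 'rV[R]_n) j : consr z ord0 (lift ord0 j) = z.2 ord0 j.
Proof. by rewrite mxE liftK. Qed.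

Lemma ge0_integral_rVS n (F : 'rV[R]_n.+1 -> \bar R) :
  measurable_fun setT F -> (forall x, 0 <= F x)%E ->
  (\int[lebesgue_rV n.+1]_x F x =
   \int[lebesgue_measure]_a \int[lebesgue_rV n]_v F (consr (a, v)))%E.
Proof.
move=> mF F0.
have mc : measurable_fun [set: measurableTypeR R * 'rV[R]_n] (@consr R n).
  exact: measurable_consr.
pose m : {measure set (measurableTypeR R * 'rV[R]_n) -> \bar R} :=
  (@lebesgue_measure R \x lebesgue_rV n)%E.
have := ge0_integral_pushforward mc m measurableT mF
  (fun y _ => F0 y).
by rewrite preimage_setT fubini_tonelli1//=; exact: measurableT_comp.
Qed.

Lemma integrable_consr n (F : 'rV[R]_n.+1 -> \bar R) :
  (lebesgue_rV n.+1).-integrable setT F ->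
  (lebesgue_measure \x lebesgue_rV n)%E.-integrable setT (F \o @consr R n).
Proof.
move=> /integrableP[mF Foo]; apply/integrableP; split.
  by apply: measurableT_comp => //; exact: measurable_consr.
rewrite fubini_tonelli1//=; last first.
  do 2 apply: measurableT_comp => //; exact: measurable_consr.
by move: Foo; rewrite ge0_integral_rVS//; exact: measurableT_comp.
Qed.

Lemma integral_rVS n (F : 'rV[R]_n.+1 -> \bar R) :
  (lebesgue_rV n.+1).-integrable setT F ->
  (\int[lebesgue_rV n.+1]_x F x =
   \int[lebesgue_measure]_a \int[lebesgue_rV n]_v F (consr (a, v)))%E.
Proof.
move=> iF; have iFc := integrable_consr iF.
have mF := measurable_int _ iF.
have mc : measurable_fun [set: measurableTypeR R * 'rV[R]_n] (@consr R n).
  exact: measurable_consr.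
pose m : {measure set (measurableTypeR R * 'rV[R]_n) -> \bar R} :=
  (@lebesgue_measure R \x lebesgue_rV n)%E.
have := integral_pushforward mc mF (mu := m) (D := setT).
by rewrite preimage_setT -integral12_prod_meas1//; exact.
Qed.

Lemma integral_rVS_swap n (F : 'rV[R]_n.+1 -> \bar R) :
  (lebesgue_rV n.+1).-integrable setT F ->
  (\int[lebesgue_rV n.+1]_x F x =
   \int[lebesgue_rV n]_v \int[lebesgue_measure]_a F (consr (a, v)))%E.
Proof.
by move=> iF; rewrite integral_rVS// (Fubini (integrable_consr iF)).
Qed.

Lemma integral_rV0 (F : 'rV[R]_0 -> \bar R) : measurable_fun setT F ->
  (\int[lebesgue_rV 0]_x F x = F 0%R)%E.
Proof. by move=> mF; rewrite integral_dirac// diracT mul1e. Qed.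

Lemma measurable_prod_rV n (k : R -> R) : measurable_fun setT k ->
  measurable_fun setT (fun x : 'rV[R]_n => \prod_i k (x ord0 i)).
Proof.
move=> mk; apply: measurable_prod => i _.
by apply: measurableT_comp => //; exact: measurable_coord_rV.
Qed.

Lemma ge0_integral_prod_rV n (k : R -> R) (c : R) : measurable_fun setT k ->
  (forall s, 0 <= k s) -> (\int[lebesgue_measure]_s (k s)%:E = c%:E)%E ->
  (\int[lebesgue_rV n]_x (\prod_i k (x ord0 i))%:E = (c ^+ n)%:E)%E.
Proof.
move=> mk k0 kc; elim: n => [|n IH].
  rewrite integral_rV0; last by apply: measurable_funEFin; exact: measurable_prod_rV.
  by rewrite big_ord0.
rewrite ge0_integral_rVS//; last 2 first.
- by apply: measurable_funEFin; exact: measurable_prod_rV.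
- by move=> x; rewrite lee_fin prodr_ge0.
under eq_integral => a _.
  under eq_integral => v _.
    rewrite big_ord_recl consr0/= EFinM.
    under eq_bigr => j _ do rewrite consrS/=.
    over.
  rewrite ge0_integralZl ?lee_fin//; last 2 first.
  - by apply: measurable_funEFin; exact: measurable_prod_rV.
  - by move=> v _; rewrite lee_fin prodr_ge0.
  rewrite IH.
  over.
rewrite ge0_integralZr//.
- by rewrite kc -EFinM exprS.
- exact: measurable_funEFin.
- by move=> s _; rewrite lee_fin.
- rewrite lee_fin exprn_ge0// -lee_fin -kc; apply: integral_ge0 => s _.
  by rewrite lee_fin.
Qed.

Definition upd n (x : 'rV[R]_n) (i : 'I_n) (s : R) : 'rV[R]_n :=
  \row_j if j == i then s else x ord0 j.

(** Fubini along the i-th coordinate. The induction peels off the first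
    coordinate: either it is the i-th one, or the induction hypothesis applies
    to almost every slice, since only almost every slice is integrable. *)
Lemma integral_slice_eq0 n (i : 'I_n) (G : 'rV[R]_n -> \bar R) :
  (lebesgue_rV n).-integrable setT G ->
  (forall x, \int[lebesgue_measure]_s G (upd x i s) = 0)%E ->
  (\int[lebesgue_rV n]_x G x = 0)%E.
Proof.
elim: n i G => [[]//|n IH] i G iG G0.
case: (unliftP ord0 i) => [j ij|i0]; last first.
  rewrite integral_rVS_swap//; apply: integral0_eq => v _.
  rewrite -[RHS](G0 (consr (0, v))); apply: eq_integral => s _.
  congr G; apply/rowP => l; rewrite [RHS]mxE i0.
  case: (unliftP ord0 l) => [m ->|->]; last first.
    by rewrite eqxx mxE unlift_none.
  by rewrite /= !mxE liftK.
rewrite integral_rVS//.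
rewrite (ae_eq_integral (cst 0)%E)//; last 2 first.
- exact: (measurable_fubini_F (integrable_consr iG)).
- apply: filterS (ae_integrable1 (integrable_consr iG)) => a /= ia _.
  apply: (IH j) => // v; rewrite -[RHS](G0 (consr (a, v))).
  apply: eq_integral => s _; congr G; apply/rowP => l; rewrite [RHS]mxE ij.
  case: (unliftP ord0 l) => [m ->|->]; last first.
    by rewrite /= !mxE unlift_none.
  rewrite !mxE liftK /= mxE; by rewrite (inj_eq lift_inj).
by rewrite integral0.
Qed.

End rV_measure.

Lemma EFin_Rintegral d (T : measurableType d) (R : realType)
    (mu : {measure set T -> \bar R}) (f : T -> R) :
  mu.-integrable setT (fun x => (f x)%:E) ->
  (\int[mu]_x (f x)%:E = (\int[mu]_x f x)%:E)%E.
Proof. by move=> i; rewrite /Rintegral fineK//; exact: integrable_fin_num i. Qed.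

(** * The Fejer kernel *)

Section fejer_kernel.
Context {R : realType}.
Local Notation leb := (@lebesgue_measure R).
Implicit Types a s t u : R.

Lemma measurable_sqrV : measurable_fun setT (fun s : R => (s ^+ 2)^-1).
Proof.
have -> : (fun s : R => (s ^+ 2)^-1) = (fun s => (s ^+ 2) `^ (-1)).
  by apply/funext => s; rewrite powR_inv1// sqr_ge0.
rewrite (_ : (fun s => _) = (@powR R ^~ (-1)) \o (fun s => s ^+ 2))//.
apply: measurableT_comp; first exact: measurable_powR.
exact: measurable_funX.
Qed.

(** The measure A |-> a * (measure of the s such that a s lies in A) agrees with
    the Lebesgue measure on the intervals, hence everywhere. *)
Lemma ge0_integral_scale a (f : R -> \bar R) : 0 < a ->
  measurable_fun setT f -> (forall s, 0 <= f s)%E ->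
  (\int[leb]_s f (a * s)%R = a^-1%:E * \int[leb]_s f s)%E.
Proof.
move=> a0 mf f0.
have ma : measurable_fun [set: measurableTypeR R]
    (fun s : R => a * s : measurableTypeR R).
  exact: mulrl_measurable.
pose m : {measure set (measurableTypeR R) -> \bar R} := leb.
have := ge0_integral_pushforward ma m measurableT mf (fun y _ => f0 y).
rewrite preimage_setT /= => <-.
have an0 : a != 0 by rewrite gt_eqF.
have a0' : 0 <= a by exact: ltW.
pose mu2 := pushforward m (fun s : R => a * s : measurableTypeR R).
have E := @lebesgue_measure_unique R
  (mscale (NngNum a0') mu2).
rewrite [in RHS](eq_measure_integral (mscale (NngNum a0') mu2)); last first.
  move=> A mA _; apply: E => //= _ [[x y]] _ <-.
  rewrite /mscale/= /mu2 /pushforward/=.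
  have -> : (fun s : R => a * s) @^-1` `]x, y] = `]x / a, y / a]%classic.
    apply/seteqP; split => s /=; rewrite !in_itv/= ltr_pdivrMr// ler_pdivlMr//;
    by rewrite mulrC.
  rewrite /m !lebesgue_measure_itv/= !lte_fin ltr_pM2r ?invr_gt0//.
  case: ifPn => _; rewrite ?mule0//.
  by rewrite -!EFinB -EFinM; congr EFin; field.
rewrite ge0_integral_mscale//= muleA -EFinM mulVf// mul1e.
exact: eq_measure_integral.
Qed.

Lemma sin_le_id s : 0 <= s -> `|sin s| <= s.
Proof.
move=> s0; have [c _] := MVT_segment s0 (f := sin) (df := cos)
  (fun x _ => is_derive_sin x) (continuous_subspaceT (@continuous_sin R)).
by rewrite sin0 !subr0 => ->; rewrite normrM (ger0_norm s0) ler_piMl// cos_max.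
Qed.

Lemma normr_sin_le s : `|sin s| <= `|s|.
Proof.
have [s0|s0] := leP 0 s; first by rewrite (ger0_norm s0) sin_le_id.
by rewrite -normrN -sinN (ltr0_norm s0) sin_le_id// oppr_ge0 ltW.
Qed.

Lemma one_sub_cos s : 1 - cos s = 2 * sin (s / 2) ^+ 2.
Proof.
rewrite {1}(_ : s = (s / 2) *+ 2); last by rewrite mulr2n; field.
by rewrite cos_mulr2n sin2cos2 mulr2n; ring.
Qed.

Lemma one_sub_cos_le s : 1 - cos s <= s ^+ 2 / 2.
Proof.
rewrite one_sub_cos.
have : sin (s / 2) ^+ 2 <= (s / 2) ^+ 2.
  by rewrite -(ger0_norm (sqr_ge0 _)) -[leRHS](ger0_norm (sqr_ge0 _)) !normrX
             lerXn2r ?nnegrE// normr_sin_le.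
lra.
Qed.

(** 1 - cos s = 2 sin(s/2)^2, and by the mean value theorem sin(s/2) is
    (s/2) cos c with c in [0, 1/2], where cos c is at least 1/2. *)
Lemma one_sub_cos_ge s : 0 <= s <= 1 -> s ^+ 2 / 8 <= 1 - cos s.
Proof.
move=> /andP[s0 s1]; rewrite one_sub_cos.
have s20 : 0 <= s / 2 by lra.
have [c] := MVT_segment s20 (f := sin) (df := cos)
  (fun x _ => is_derive_sin x) (continuous_subspaceT (@continuous_sin R)).
rewrite in_itv/= sin0 !subr0 => /andP[c0 cs] ->.
have cc := one_sub_cos_le c.
have c2 : 1 / 2 <= cos c by nra.
have : (s / 4) ^+ 2 <= (cos c * (s / 2)) ^+ 2 by rewrite lerXn2r ?nnegrE//; nra.
rewrite !expr2; lra.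
Qed.

(** The Fejer kernel of the line, up to a constant. As 0^-1 = 0, its value at
    the origin is 0 instead of the limit 1/2, and [fejer_ge_eighth] therefore
    excludes the origin. *)
Definition fejer s : R := (1 - cos s) / s ^+ 2.

Lemma fejer_ge0 s : 0 <= fejer s.
Proof. by rewrite divr_ge0 ?sqr_ge0// subr_ge0 cos_le1. Qed.

Lemma fejer_le_half s : fejer s <= 2^-1.
Proof.
have [->|s0] := eqVneq s 0; first by rewrite /fejer expr0n invr0 mulr0 invr_ge0.
rewrite /fejer ler_pdivrMr ?exprn_even_gt0//.
by rewrite mulrC one_sub_cos_le.
Qed.

Lemma fejer_ge_eighth s : 0 < s <= 1 -> 8^-1 <= fejer s.
Proof.
move=> /andP[s0 s1]; rewrite /fejer ler_pdivlMr ?exprn_gt0//.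
by rewrite mulrC one_sub_cos_ge// ltW.
Qed.

(** The kernel is at most 1/2 everywhere and at most 2 / s^2. *)
Lemma fejer_le s : fejer s <= 4 * (1 + s ^+ 2)^-1.
Proof.
have p1 : 0 < 1 + s ^+ 2 by rewrite ltr_wpDr ?sqr_ge0.
rewrite ler_pdivlMr//.
have f2 := fejer_le_half s; have f0 := fejer_ge0 s.
have : fejer s * s ^+ 2 <= 2.
  have [->|s0] := eqVneq s 0; first by rewrite expr0n mulr0.
  by rewrite /fejer mulfVK ?expf_neq0//; have := cos_geN1 s; lra.
rewrite mulrDr mulr1; lra.
Qed.

Lemma measurable_fejer : measurable_fun setT fejer.
Proof.
apply: measurable_funM; last exact: measurable_sqrV.
apply: measurable_funB => //; apply: continuous_measurable_fun.
exact: continuous_cos.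
Qed.

Lemma integral_poisson : (\int[leb]_s ((1 + s ^+ 2)^-1)%:E = (pi : R)%:E)%E.
Proof.
rewrite (ge0_symfun_integralT (f := fun s => (1 + s ^+ 2)^-1)).
- rewrite -set_itvcy integral0y_oneDsqr -EFinM; congr EFin.
  by field.
- by move=> s; rewrite invr_ge0 addr_ge0// sqr_ge0.
- exact: continuous_oneDsqrV.
- by move=> s /=; rewrite sqrrN.
Qed.

Lemma measurable_poisson : measurable_fun setT (fun s : R => (1 + s ^+ 2)^-1).
Proof.
by apply: continuous_measurable_fun; exact: continuous_oneDsqrV.
Qed.

Lemma integrable_poisson : leb.-integrable setT (fun s => ((1 + s ^+ 2)^-1)%:E).
Proof.
apply/integrableP; split; first exact: measurable_funEFin measurable_poisson.
under eq_integral => s _ do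
  rewrite /= ger0_norm ?invr_ge0 ?addr_ge0 ?sqr_ge0//.
by rewrite integral_poisson ltry.
Qed.

Lemma integrable_fejer : leb.-integrable setT (EFin \o fejer).
Proof.
apply: (le_integrable measurableT _ _ (integrableZl measurableT 4 integrable_poisson)).
  exact: measurable_funEFin measurable_fejer.
move=> s _ /=; rewrite lee_fin ger0_norm ?fejer_ge0//.
by rewrite (le_trans (fejer_le s))// ler_norm.
Qed.

(** Unlike fejer (a * s), this function of a is affine in cos (a * s), so
    products with cosines are combinations of values at other a. *)
Definition dilated_fejer a s : R := (1 - cos (a * s)) / s ^+ 2.

Lemma dilated_fejerE a s : dilated_fejer a s = `|a| ^+ 2 * fejer (`|a| * s).
Proof.
have [->|a0] := eqVneq a 0.
  by rewrite /dilated_fejer mul0r cos0 subrr mul0r normr0 expr0n mul0r.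
have [->|s0] := eqVneq s 0.
  by rewrite /dilated_fejer /fejer !mulr0 !expr0n !invr0 !mulr0.
rewrite /dilated_fejer; have -> : cos (a * s) = cos (`|a| * s).
  by rewrite -[LHS]cos_norm -[RHS]cos_norm !normrM normr_id.
have : `|a| != 0 by rewrite normr_eq0.
by rewrite /fejer => na0; field; rewrite s0 na0.
Qed.

Lemma integral_fejer_scale a : 0 < a ->
  (\int[leb]_s (fejer (a * s))%:E = a^-1%:E * \int[leb]_s (fejer s)%:E)%E.
Proof.
move=> a0; rewrite (ge0_integral_scale (f := EFin \o fejer))//.
- exact: measurable_funEFin measurable_fejer.
- by move=> s; rewrite lee_fin fejer_ge0.
Qed.

Lemma measurable_fejer_scale a : measurable_fun setT (fun s => fejer (a * s)).
Proof.
by apply: measurableT_comp; [exact: measurable_fejer|exact: mulrl_measurable].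
Qed.

Lemma integrable_fejer_scale a : 0 < a ->
  leb.-integrable setT (fun s => (fejer (a * s))%:E).
Proof.
move=> a0; apply/integrableP; split.
  exact: measurable_funEFin (measurable_fejer_scale a).
under eq_integral => s _ do rewrite /= ger0_norm ?fejer_ge0//.
rewrite integral_fejer_scale//.
have /integrableP[_] := integrable_fejer.
under eq_integral => s _ do rewrite /= ger0_norm ?fejer_ge0//.
by move=> h; rewrite lte_mul_pinfty// lee_fin invr_ge0 ltW.
Qed.

Lemma integrable_dilated_fejer a :
  leb.-integrable setT (EFin \o dilated_fejer a).
Proof.
have -> : EFin \o dilated_fejer a =
    fun s => ((`|a| ^+ 2)%:E * (fejer (`|a| * s))%:E)%E.
  by apply/funext => s /=; rewrite dilated_fejerE EFinM.
have [->|a0] := eqVneq a 0.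
  rewrite normr0 expr0n/=; under eq_fun do rewrite mul0e.
  exact: integrable0.
by apply: integrableZl => //; apply: integrable_fejer_scale; rewrite normr_gt0.
Qed.

Lemma Rintegral_dilated_fejer a :
  \int[leb]_s dilated_fejer a s = `|a| * \int[leb]_s fejer s.
Proof.
under eq_Rintegral do rewrite dilated_fejerE.
have [->|a0] := eqVneq a 0.
  rewrite normr0 !mul0r expr0n/=; under eq_Rintegral do rewrite mul0r.
  by rewrite /Rintegral integral0.
have na0 : 0 < `|a| by rewrite normr_gt0.
rewrite RintegralZl//; last exact: integrable_fejer_scale.
rewrite {1}/Rintegral integral_fejer_scale// fineM//; last first.
  exact: integrable_fin_num integrable_fejer.
by rewrite mulrA expr2 mulfK// gt_eqF.
Qed.

(** Up to a factor, the integrand is the second difference with step v, at the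
    point u, of a |-> (1 - cos (a s)) / s^2. The integral of the latter is
    proportional to |a|, and the second difference of the modulus vanishes when
    0 is not strictly between u - v and u + v. *)
Lemma integral_fejer_cos v u : 0 < v -> v <= `|u| ->
  (\int[leb]_s (fejer (v * s) * cos (u * s))%:E = 0)%E.
Proof.
move=> v0 uv; have vn0 : v != 0 by rewrite gt_eqF.
have E s : fejer (v * s) * cos (u * s) =
  (v ^- 2 / 2) * (dilated_fejer (u + v) s + dilated_fejer (u - v) s)
  - v ^- 2 * dilated_fejer u s.
  rewrite /dilated_fejer (mulrDl u) (mulrBl _ u) cosD cosB /fejer.
  have [->|s0] := eqVneq s 0.
    by rewrite !mulr0 expr0n /= invr0 !mulr0 addr0 mulr0 mul0r subr0.
  set c := cos (v * s); set d := sin _; set e := cos _; set f := sin _.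
  by field; rewrite vn0 s0.
have iD a b : leb.-integrable setT (EFin \o (fun s => dilated_fejer a s + dilated_fejer b s)).
  exact: integrableD (integrable_dilated_fejer a) (integrable_dilated_fejer b).
have iZ k (f : R -> R) : leb.-integrable setT (EFin \o f) ->
    leb.-integrable setT (EFin \o (fun s => k * f s)).
  by move=> fi; exact: (integrableZl measurableT k fi).
have i1 := iZ (v ^- 2 / 2) _ (iD (u + v) (u - v)).
have i2 := iZ (v ^- 2) _ (integrable_dilated_fejer u).
under eq_integral do rewrite E.
rewrite EFin_Rintegral; last exact: (integrableB measurableT i1 i2).
rewrite RintegralB// RintegralZl// RintegralD//; try exact: integrable_dilated_fejer.
rewrite RintegralZl//; last exact: integrable_dilated_fejer.
rewrite !Rintegral_dilated_fejer; congr EFin.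
have : `|u + v| + `|u - v| = 2 * `|u|.
  have [u0|u0] := leP 0 u.
    move: uv; rewrite (ger0_norm u0) => uv.
    by rewrite !ger0_norm; lra.
  move: uv; rewrite (ltr0_norm u0) => uv.
  by rewrite !ler0_norm; lra.
set J := Rintegral _ _ _; move=> h.
rewrite -mulrDl h; by field.
Qed.

Lemma integrable_fejer_scaleM a (b : R -> R) : 0 < a ->
  measurable_fun setT b -> (forall s, `|b s| <= 1) ->
  leb.-integrable setT (fun s => (fejer (a * s) * b s)%:E).
Proof.
move=> a0 mb b1; apply: (le_integrable measurableT _ _ (integrable_fejer_scale a0)).
  by apply: measurable_funEFin; apply: measurable_funM => //; exact: measurable_fejer_scale.
move=> s _ /=; rewrite lee_fin normrM ler_piMr//.
Qed.

Lemma fejerN s : fejer (- s) = fejer s.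
Proof. by rewrite /fejer cosN sqrrN. Qed.

(** The integrand is odd. *)
Lemma integral_fejer_sin v u : 0 < v ->
  (\int[leb]_s (fejer (v * s) * sin (u * s))%:E = 0)%E.
Proof.
move=> v0; pose F s := (fejer (v * s) * sin (u * s))%:E.
have iF : leb.-integrable setT F.
  apply: integrable_fejer_scaleM => [||s]; rewrite ?sin_max//.
  apply: measurableT_comp; last exact: mulrl_measurable.
  by apply: continuous_measurable_fun; exact: continuous_sin.
have FN s : F (- s) = ((-1)%:E * F s)%E.
  by rewrite /F !mulrN fejerN sinN mulrN -EFinM mulN1r.
have mN : measurable_fun [set: measurableTypeR R]
    (-%R : R -> measurableTypeR R) by exact: oppr_measurable.
pose m : {measure set (measurableTypeR R) -> \bar R} := leb.
have mF := measurable_int _ iF.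
have := integral_pushforward mN mF (mu := m) (D := setT).
rewrite preimage_setT.
have -> : F \o -%R = (fun s => (-1)%:E * F s)%E by apply/funext => s /=; exact: FN.
move=> /(_ (integrableZl measurableT (-1) iF) measurableT).
have -> : (\int[pushforward m (-%R : R -> measurableTypeR R)]_x F x = \int[leb]_x F x)%E.
  by apply: eq_measure_integral => A mA _; exact: lebesgue_measureN.
rewrite integralZl// EFin_Rintegral// -EFinM => -[h]; congr EFin; lra.
Qed.

End fejer_kernel.

(** * Complex exponentials *)

Section complex_exponentials.
Context {R : realType}.
Local Open Scope complex_scope.
Local Notation normc := (@ComplexField.Normc.normc R).
Implicit Types (s t y : R) (z w : R[i]).

Lemma cReD z w : complex.Re (z + w) = complex.Re z + complex.Re w.
Proof. by case: z w => [a b] [c d]. Qed.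

Lemma cImD z w : complex.Im (z + w) = complex.Im z + complex.Im w.
Proof. by case: z w => [a b] [c d]. Qed.

Lemma cReN z : complex.Re (- z) = - complex.Re z.
Proof. by case: z. Qed.

Lemma cImN z : complex.Im (- z) = - complex.Im z.
Proof. by case: z. Qed.

Lemma cReM z w : complex.Re (z * w) =
  complex.Re z * complex.Re w - complex.Im z * complex.Im w.
Proof. by case: z w => [a b] [c d]. Qed.

Lemma cImM z w : complex.Im (z * w) =
  complex.Re z * complex.Im w + complex.Im z * complex.Re w.
Proof. by case: z w => [a b] [c d]. Qed.

Lemma cReZ t w : complex.Re (t%:C * w) = t * complex.Re w.
Proof. by rewrite cReM/= mul0r subr0. Qed.

Lemma cImZ t w : complex.Im (t%:C * w) = t * complex.Im w.
Proof. by rewrite cImM/= mul0r addr0. Qed.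

Lemma cRe_sum (I : Type) (r : seq I) (F : I -> R[i]) :
  complex.Re (\sum_(i <- r) F i) = \sum_(i <- r) complex.Re (F i).
Proof. by apply: (big_morph _ cReD). Qed.

Lemma cIm_sum (I : Type) (r : seq I) (F : I -> R[i]) :
  complex.Im (\sum_(i <- r) F i) = \sum_(i <- r) complex.Im (F i).
Proof. by apply: (big_morph _ cImD). Qed.

Lemma normc_sqrtE z : normc z = Num.sqrt (complex.Re z ^+ 2 + complex.Im z ^+ 2).
Proof. by case: z. Qed.

Lemma normc_ge0 z : 0 <= normc z.
Proof. by rewrite normc_sqrtE sqrtr_ge0. Qed.

Lemma normr_Re_le z : `|complex.Re z| <= normc z.
Proof. by rewrite normc_sqrtE -sqrtr_sqr ler_wsqrtr// lerDl sqr_ge0. Qed.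

Lemma normr_Im_le z : `|complex.Im z| <= normc z.
Proof. by rewrite normc_sqrtE -sqrtr_sqr ler_wsqrtr// lerDr sqr_ge0. Qed.

Lemma normc_real t : normc t%:C = `|t|.
Proof. by rewrite normc_sqrtE/= expr0n addr0 sqrtr_sqr. Qed.

Lemma normc_le_ReIm z : normc z <= `|complex.Re z| + `|complex.Im z|.
Proof.
rewrite {1}(complexE z) (le_trans (le_normcD _ _))// ComplexField.Normc.normcM.
rewrite !normc_real lerD2l.
by rewrite [normc _]normc_sqrtE/= expr0n expr1n add0r sqrtr1 mul1r.
Qed.

Lemma normc_sum_le (I : Type) (r : seq I) (F : I -> R[i]) :
  normc (\sum_(i <- r) F i) <= \sum_(i <- r) normc (F i).
Proof.
elim/big_rec2: _ => [|i a z _ h]; first by rewrite ComplexField.Normc.normc0.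
by rewrite (le_trans (le_normcD _ _))// lerD2l.
Qed.

Lemma cis0 : cis 0 = 1 :> R[i].
Proof. by rewrite /cis cos0 sin0. Qed.

Lemma cisD s t : cis (s + t) = cis s * cis t :> R[i].
Proof.
rewrite /cis cosD sinD; apply/eqP; rewrite eq_complex/=.
by rewrite eqxx/= addrC.
Qed.

Lemma cis_sum (I : Type) (r : seq I) (F : I -> R) :
  cis (\sum_(i <- r) F i) = \prod_(i <- r) cis (F i) :> R[i].
Proof. by apply: (big_morph _ cisD); exact: cis0. Qed.

Lemma cisX s k : cis (s *+ k) = cis s ^+ k :> R[i].
Proof. by elim: k => [|k IH]; rewrite ?cis0// mulrS cisD IH exprS. Qed.

Lemma normc_cis s : normc (cis s) = 1.
Proof. by rewrite normc_sqrtE/= cos2Dsin2 sqrtr1. Qed.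

Lemma cisMN s : cis s * cis (- s) = 1 :> R[i].
Proof. by rewrite -cisD subrr cis0. Qed.

(** |exp(iu) - 1| is at most |1 - cos u| + |sin u|, and both terms are at most
    |u|, the first one because it is 2 sin(u/2)^2. *)
Lemma normr_cis_sub_le s t : normc (cis s - cis t) <= 2 * `|s - t|.
Proof.
rewrite -[s](subrK t) cisD -{2}[cis t]mul1r -mulrBl ComplexField.Normc.normcM.
rewrite normc_cis mulr1 subrK; set u := s - t.
rewrite (le_trans (normc_le_ReIm _))// !cReD !cImD !cReN !cImN/= subr0.
rewrite mulr_natl mulr2n lerD ?normr_sin_le//.
rewrite distrC ger0_norm ?subr_ge0 ?cos_le1// one_sub_cos.
have := normr_sin_le (u / 2); rewrite normrM.
rewrite (_ : `|2^-1 : R| = 2^-1); last by rewrite ger0_norm.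
move=> h; have := sin_max (u / 2); have := normr_ge0 (sin (u / 2)).
rewrite -[sin _ ^+ 2]ger0_norm ?sqr_ge0// normrX expr2; nra.
Qed.

(** 2 - 2 cos s is the square of the modulus of 1 - exp(is). *)
Lemma one_sub_cos_cis s :
  (1 - cos s)%:C + (1 - cos s)%:C = (1 - cis s) * (1 - cis (- s)).
Proof.
rewrite [RHS](_ : _ = 1 - cis s - cis (- s) + cis s * cis (- s)); last by ring.
rewrite cisMN; apply/eqP; rewrite eq_complex ?(cReD, cImD, cReN, cImN)/= cosN sinN.
by apply/andP; split; apply/eqP; ring.
Qed.

Lemma one_sub_cisX s k :
  1 - cis (k%:R * s) = (1 - cis s) * \sum_(a < k) cis (a%:R * s) :> R[i].
Proof.
rewrite mulr_natl cisX -opprB subrX1 -mulNr opprB; congr *%R.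
by apply: eq_bigr => a _; rewrite mulr_natl cisX.
Qed.

(** The Fejer kernel at scale N is the kernel at scale 1 times a positive
    trigonometric polynomial: by the previous two lemmas,
    (1 - cos (N s)) / (1 - cos s) is the square of the modulus of the sum of the
    exp(i a s) for a < N. The coefficients N^-2 add up to 1, so the polynomial
    is a mean of exponentials. *)
Lemma fejer_refine (N : nat) s : (0 < N)%N ->
  (fejer (N%:R * s))%:C = (fejer s)%:C * ((N%:R ^- 2 : R)%:C *
    \sum_(q : 'I_N * 'I_N) cis ((q.1%:R - q.2%:R) * s)).
Proof.
move=> N0; have Nn0 : N%:R != 0 :> R by rewrite pnatr_eq0 -lt0n.
have -> : \sum_(q : 'I_N * 'I_N) cis ((q.1%:R - q.2%:R) * s) =
    (\sum_(a < N) cis (a%:R * s)) * (\sum_(a < N) cis (a%:R * - s)) :> R[i].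
  rewrite big_distrlr/= pair_bigA/=; apply: eq_bigr => q _.
  by rewrite -cisD mulrBl mulrN.
have E : (1 - cos (N%:R * s))%:C = (1 - cos s)%:C *
    ((\sum_(a < N) cis (a%:R * s)) * (\sum_(a < N) cis (a%:R * - s))).
  have c2 : 2%:R != 0 :> R[i] by rewrite pnatr_eq0.
  apply: (mulfI c2); rewrite [RHS]mulrA !(mulr_natl _ 2) !mulr2n !one_sub_cos_cis.
  by rewrite -mulrN !one_sub_cisX; ring.
rewrite /fejer rmorphM/= E exprMn invfM !rmorphM/=; ring.
Qed.

End complex_exponentials.

(** * Complex-valued measurable functions *)

Section cmeasurable_theory.
Context {R : realType} {n : nat}.
Local Open Scope complex_scope.
Local Notation V := 'rV[R]_n.
Implicit Types f g : V -> R[i].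

Lemma cmeasurable_cst (z : R[i]) : cmeasurable (fun _ : V => z).
Proof. by split; exact: measurable_cst. Qed.

Lemma cmeasurable_real (f : V -> R) : measurable_fun setT f ->
  cmeasurable (fun x => (f x)%:C).
Proof. by move=> mf; split => //=; exact: measurable_cst. Qed.

Lemma cmeasurableD f g : cmeasurable f -> cmeasurable g ->
  cmeasurable (fun x => f x + g x).
Proof.
move=> [f1 f2] [g1 g2]; split.
- by under eq_fun do rewrite cReD; exact: measurable_funD.
- by under eq_fun do rewrite cImD; exact: measurable_funD.
Qed.

Lemma cmeasurableN f : cmeasurable f -> cmeasurable (fun x => - f x).
Proof.
move=> [f1 f2]; split.
- by under eq_fun do rewrite cReN; exact: measurableT_comp.
- by under eq_fun do rewrite cImN; exact: measurableT_comp.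
Qed.

Lemma cmeasurableM f g : cmeasurable f -> cmeasurable g ->
  cmeasurable (fun x => f x * g x).
Proof.
move=> [f1 f2] [g1 g2]; split.
- by under eq_fun do rewrite cReM; apply: measurable_funB; exact: measurable_funM.
- by under eq_fun do rewrite cImM; apply: measurable_funD; exact: measurable_funM.
Qed.

Lemma cmeasurable_sum (I : Type) (r : seq I) (F : I -> V -> R[i]) :
  (forall i, cmeasurable (F i)) -> cmeasurable (fun x => \sum_(i <- r) F i x).
Proof.
move=> mF; elim: r => [|i r IH].
  by under eq_fun do rewrite big_nil; exact: cmeasurable_cst.
by under eq_fun do rewrite big_cons; exact: cmeasurableD.
Qed.

Lemma measurable_dot (d : V) : measurable_fun setT (fun x : V => dot d x).
Proof.
apply: measurable_sum => i; apply: measurable_funM => //.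
exact: measurable_coord_rV.
Qed.

Lemma cmeasurable_cis (f : V -> R) : measurable_fun setT f ->
  cmeasurable (fun x => cis (f x)).
Proof.
move=> mf; split => /=; apply: measurableT_comp => //;
  apply: continuous_measurable_fun.
- exact: continuous_cos.
- exact: continuous_sin.
Qed.

Lemma measurable_normc f : cmeasurable f ->
  measurable_fun setT (fun x => ComplexField.Normc.normc (f x)).
Proof.
move=> [f1 f2]; under eq_fun do rewrite normc_sqrtE -powR12_sqrt ?addr_ge0 ?sqr_ge0//.
apply: (@measurableT_comp _ _ _ _ _ _ (fun t : R => t `^ 2^-1)).
  exact: measurable_powR.
by apply: measurable_funD; exact: measurable_funX.
Qed.

End cmeasurable_theory.

(** * The exponential potential *)

Section exponential_potential.
Context {R : realType}.
Local Open Scope complex_scope.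
Local Notation normc := (@ComplexField.Normc.normc R).
Implicit Types (t m y : R) (z w : R[i]).

(** From exp(-y) >= 1 - y, by comparison of 1 / (1 - y) with the right side. *)
Lemma expR_le_quad y : y <= 2^-1 -> expR y <= 1 + y + 2 * y ^+ 2.
Proof.
move=> y2; have y1 : 0 < 1 - y by lra.
have := expR_ge1Dx (- y); rewrite expRN => h.
have : expR y <= (1 - y)^-1.
  by rewrite -[expR y]invrK lef_pV2 ?posrE ?invr_gt0 ?expR_gt0.
move=> /le_trans; apply; rewrite -div1r ler_pdivrMr// expr2.
have : 0 <= y * y * (1 - 2 * y).
  by rewrite mulr_ge0// -?expr2 ?sqr_ge0//; lra.
lra.
Qed.

(** The terms linear in the F j cancel; only quadratic ones remain. *)
Lemma sum_expR_le (I : finType) (F : I -> R) m t :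
  m <= 2^-1 -> (forall j, `|F j| <= m) -> \sum_j F j = 0 ->
  \sum_j expR (t + F j) <= #|I|%:R * (expR (2 * m ^+ 2) * expR t).
Proof.
move=> m2 Fm F0.
have q j : expR (t + F j) <= expR t * (1 + F j + 2 * m ^+ 2).
  rewrite expRD ler_wpM2l ?expR_ge0// (le_trans (expR_le_quad _))//.
    by rewrite (le_trans (ler_norm _))// (le_trans (Fm j)).
  rewrite lerD2l ler_wpM2l// -[F j ^+ 2]ger0_norm ?sqr_ge0// normrX.
  by rewrite lerXn2r ?nnegrE// (le_trans _ (Fm j)).
rewrite (le_trans (ler_sum _ (fun j _ => q j)))// -mulr_sumr !big_split/= F0.
rewrite addr0 !sumr_const -mulrnDl -[(_ + _) *+ _]mulr_natl.
rewrite mulrCA ler_wpM2l// mulrC ler_wpM2r ?expR_ge0//.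
exact: expR_ge1Dx.
Qed.

(** A substitute for the exponential of the modulus: it dominates every power
    of the modulus, and adding perturbations of mean zero and of modulus at most
    m <= 1/2 multiplies its mean by at most exp (2 m^2) ([sum_pot_le]). *)
Definition pot z : R := expR (complex.Re z) + expR (- complex.Re z) +
  (expR (complex.Im z) + expR (- complex.Im z)).

Lemma pot_ge0 z : 0 <= pot z.
Proof. by rewrite !addr_ge0 ?expR_ge0. Qed.

Lemma sum_pot_le (I : finType) (F : I -> R[i]) m z :
  m <= 2^-1 -> (forall j, normc (F j) <= m) -> \sum_j F j = 0 ->
  \sum_j pot (z + F j) <= #|I|%:R * (expR (2 * m ^+ 2) * pot z).
Proof.
move=> m2 Fm F0.
have re j : `|complex.Re (F j)| <= m by exact: le_trans (normr_Re_le _) (Fm j).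
have im j : `|complex.Im (F j)| <= m by exact: le_trans (normr_Im_le _) (Fm j).
have re0 : \sum_j complex.Re (F j) = 0 by rewrite -cRe_sum F0.
have im0 : \sum_j complex.Im (F j) = 0 by rewrite -cIm_sum F0.
have re' j : `|- complex.Re (F j)| <= m by rewrite normrN.
have im' j : `|- complex.Im (F j)| <= m by rewrite normrN.
have re0' : \sum_j - complex.Re (F j) = 0 by rewrite sumrN re0 oppr0.
have im0' : \sum_j - complex.Im (F j) = 0 by rewrite sumrN im0 oppr0.
rewrite /pot; under eq_bigr do rewrite cReD cImD !opprD.
rewrite !big_split/= !mulrDr !lerD//; exact: sum_expR_le.
Qed.

(** y / p <= exp (y / p), raised to the power p. *)
Lemma powR_le_expR p y : 1 <= p -> 0 <= y -> y `^ p <= p `^ p * expR y.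
Proof.
move=> p1 y0; have p0 : 0 < p by rewrite (lt_le_trans _ p1).
have -> : expR y = expR (y / p) `^ p by rewrite -expRM mulfVK// gt_eqF.
rewrite -powRM ?expR_ge0 ?(ltW p0)//.
apply: ge0_ler_powR; rewrite ?nnegrE ?mulr_ge0 ?expR_ge0 ?(ltW p0)//.
rewrite mulrC -ler_pdivrMr//.
by rewrite (le_trans _ (expR_ge1Dx _))// lerDr.
Qed.

Lemma normc_powR_le_pot p z : 1 <= p ->
  normc z `^ p <= (2 * p) `^ p * pot z.
Proof.
move=> p1; have p0 : 0 <= p by rewrite (le_trans _ p1).
have ex y : expR `|y| <= expR y + expR (- y).
  have [y0|y0] := leP 0 y.
    by rewrite (ger0_norm y0) lerDl expR_ge0.
  by rewrite (ltr0_norm y0) lerDr expR_ge0.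
have main y : `|y| `^ p <= p `^ p * (expR y + expR (- y)).
  by rewrite (le_trans (powR_le_expR p1 (normr_ge0 y)))// ler_wpM2l ?powR_ge0.
have zle : normc z `^ p <=
    2 `^ p * (`|complex.Re z| `^ p + `|complex.Im z| `^ p).
  wlog h : / normc z <= 2 * Num.max `|complex.Re z| `|complex.Im z|.
    apply; rewrite (le_trans (normc_le_ReIm z))// mulr_natl mulr2n lerD//.
    - by rewrite le_max lexx.
    - by rewrite le_max lexx orbT.
  have := h; rewrite maxEle; case: ifP => _ {}h.
  - rewrite (le_trans (ge0_ler_powR p0 _ _ h)) ?nnegrE ?normc_ge0 ?mulr_ge0//.
    by rewrite powRM// ler_wpM2l ?powR_ge0// lerDr powR_ge0.
  - rewrite (le_trans (ge0_ler_powR p0 _ _ h)) ?nnegrE ?normc_ge0 ?mulr_ge0//.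
    by rewrite powRM// ler_wpM2l ?powR_ge0// lerDl powR_ge0.
rewrite (le_trans zle)// powRM// -mulrA ler_wpM2l ?powR_ge0//.
by rewrite mulrDr lerD.
Qed.

End exponential_potential.

(** * Conditional expectations *)

Section greedy_selection.
Context {R : realType} {n : nat}.
Local Open Scope complex_scope.
Local Notation normc := (@ComplexField.Normc.normc R).
Local Notation V := 'rV[R]_n.
Local Notation mu := (@lebesgue_rV R n).
Variables (A : Type) (I : finType) (e : A -> I -> V -> R[i]).
Hypothesis me : forall a j, cmeasurable (e a j).
Hypothesis e1 : forall a j x, normc (e a j x) <= 1.

(** Deviation of the choice j from the mean over all the choices. *)
Definition centered (a : A) (j : I) (x : V) : R[i] :=
  e a j x - (#|I|%:R^-1)%:C * \sum_k e a k x.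

Lemma cmeasurable_centered a j : cmeasurable (centered a j).
Proof.
apply: cmeasurableD => //; apply: cmeasurableN; apply: cmeasurableM.
  exact: cmeasurable_cst.
exact: cmeasurable_sum.
Qed.

Hypothesis I0 : (0 < #|I|)%N.

Lemma sum_centered a x : \sum_j centered a j x = 0.
Proof.
rewrite sumrB sumr_const -[X in _ - X]mulr_natl.
rewrite mulrA fmorphV/= rmorph_nat divff ?mul1r ?subrr//.
by rewrite pnatr_eq0 -lt0n.
Qed.

Lemma normc_centered a j x : normc (centered a j x) <= 2.
Proof.
rewrite (le_trans (le_normcD _ _))// normcN (_ : 2 = 1 + 1)// lerD//.
rewrite ComplexField.Normc.normcM normc_real ger0_norm ?invr_ge0//.
rewrite mulrC ler_pdivrMr ?ltr0n// mul1r (le_trans (normc_sum_le _ _))//.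
by rewrite (le_trans (ler_sum _ (fun j _ => e1 a j x)))// sumr_const -[leLHS]mulr_natl mulr1.
Qed.

Variables (W : V -> R) (lam : R).
Hypotheses (mW : measurable_fun setT W) (W0 : forall x, 0 <= W x).
Hypotheses (lam0 : 0 <= lam) (lam2 : 2 * lam <= 2^-1).

(* The factor of sum_pot_le for terms of modulus at most 2 * lam. *)
Let growth : R := expR (2 * (2 * lam) ^+ 2).

Let Phi (S : V -> R[i]) : \bar R := (\int[mu]_x (W x * pot (lam%:C * S x))%:E)%E.

Let measurable_Wpot (S : V -> R[i]) : cmeasurable S ->
  measurable_fun setT (fun x => W x * pot (lam%:C * S x)).
Proof.
move=> mS; apply: measurable_funM => //.
have [m1 m2] := cmeasurableM (cmeasurable_cst lam%:C) mS.
apply: measurable_funD; apply: measurable_funD;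
  by apply: (measurableT_comp (@measurable_expR R)) => //; exact: measurableT_comp.
Qed.

Let Wpot_ge0 S x : (0 <= (W x * pot (lam%:C * S x))%:E)%E.
Proof. by rewrite lee_fin mulr_ge0 ?pot_ge0. Qed.

(** The mean over j of the potential is at most growth times the previous
    potential, so the j with the least potential does as well. *)
Lemma greedy_step a (S : V -> R[i]) : cmeasurable S ->
  exists j, (Phi (fun x => centered a j x + S x)%R <= growth%:E * Phi S)%E.
Proof.
move=> mS; have [j0 _] : exists j : I, j \in I by apply/card_gt0P.
pose j := [arg min_(k < j0) Phi (fun x => centered a k x + S x)%R]%O.
exists j; rewrite /j; case: arg_minP => // {}j _ jmin.
have msum k : cmeasurable (fun x => centered a k x + S x)%R.
  by apply: cmeasurableD => //; exact: cmeasurable_centered.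
have : (\sum_k Phi (fun x => centered a k x + S x)%R <=
    #|I|%:R%:E * (growth%:E * Phi S))%E.
  pose h k x := (W x * pot (lam%:C * (centered a k x + S x)))%:E.
  have mh k : measurable_fun setT (h k).
    by apply: measurable_funEFin; exact: measurable_Wpot.
  have h0 k x : setT x -> (0 <= h k x)%E.
    by move=> _; rewrite lee_fin mulr_ge0 ?pot_ge0.
  rewrite -[leLHS](ge0_integral_sum mu measurableT mh h0).
  rewrite muleA -EFinM -ge0_integralZl_EFin//; last 2 first.
  - by apply: measurable_funEFin; exact: measurable_Wpot.
  - by rewrite mulr_ge0 ?expR_ge0.
  apply: ge0_le_integral => //.
  - by move=> x _; apply: sume_ge0 => k _; exact: h0.
  - exact: emeasurable_sum.
  - apply: measurable_funEFin; apply: measurable_funM => //; exact: measurable_Wpot.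
  move=> x _; rewrite /h sumEFin lee_fin -mulr_sumr mulrCA ler_wpM2l//.
  under eq_bigr do rewrite mulrDr addrC.
  rewrite -mulrA; apply: sum_pot_le => //.
  - move=> k; rewrite ComplexField.Normc.normcM normc_real ger0_norm// mulrC.
    by rewrite ler_wpM2r// normc_centered.
  - by rewrite -mulr_sumr sum_centered mulr0.
move=> h; rewrite -(@lee_pmul2l _ #|I|%:R%:E) ?lte_fin ?ltr0n//.
apply: le_trans h.
rewrite (_ : #|I|%:R%:E = \sum_(k : I) 1)%E; last first.
  by rewrite sumEFin sumr_const.
by rewrite ge0_sume_distrl//; apply: lee_sum => k _; rewrite mul1e jmin.
Qed.

(** The choices are made one after the other, each at the cost of one factor
    growth; 4 is the value of pot at 0. *)
Lemma greedy_selection (P : seq A) : exists2 js : seq I, size js = size P &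
  (\int[mu]_x (W x * pot (lam%:C *
     \sum_(q <- zip P js) centered q.1 q.2 x))%:E <=
   (4 * growth ^+ size P)%:E * \int[mu]_x (W x)%:E)%E.
Proof.
elim: P => [|a P [js sjs IH]].
  exists [::] => //; rewrite expr0 mulr1 -ge0_integralZl_EFin//; last 2 first.
  - by move=> x _; rewrite lee_fin.
  - exact: measurable_funEFin.
  rewrite le_eqVlt; apply/orP; left; apply/eqP; apply: eq_integral => x _.
  rewrite big_nil mulr0 /pot/= oppr0 expR0 -EFinM; congr EFin.
  by rewrite mulrC; congr *%R; ring.
have mS : cmeasurable (fun x => \sum_(q <- zip P js) centered q.1 q.2 x).
  by apply: cmeasurable_sum => q; exact: cmeasurable_centered.
have [j jP] := greedy_step a mS.
exists (j :: js); first by rewrite /= sjs.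
rewrite /=; under eq_integral do rewrite big_cons.
rewrite (le_trans jP)// exprS mulrCA EFinM -muleA.
by rewrite lee_wpmul2l// lee_fin expR_ge0.
Qed.

End greedy_selection.

(** * Refinement of the trigonometric sums *)

Section dot_theory.
Context {R : realType} {n : nat}.
Implicit Types x y z t : 'rV[R]_n.

Lemma dotDl x y z : dot (x + y) z = dot x z + dot y z.
Proof. by rewrite /dot -big_split; apply: eq_bigr => i _; rewrite mxE mulrDl. Qed.

Lemma dotNl x z : dot (- x) z = - dot x z.
Proof. by rewrite /dot -sumrN; apply: eq_bigr => i _; rewrite mxE mulNr. Qed.

Lemma dotBl x y z : dot (x - y) z = dot x z - dot y z.
Proof. by rewrite dotDl dotNl. Qed.

Lemma dotZl (r : R) x z : dot (r *: x) z = r * dot x z.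
Proof. by rewrite /dot mulr_sumr; apply: eq_bigr => i _; rewrite mxE mulrA. Qed.

Lemma dotC x y : dot x y = dot y x.
Proof. by apply: eq_bigr => i _; rewrite mulrC. Qed.

Lemma integrable_mul_dot (h : 'rV[R]_n -> R) (b : R -> R) t :
  (lebesgue_rV n).-integrable setT (EFin \o h) ->
  continuous b -> (forall s, `|b s| <= 1) ->
  (lebesgue_rV n).-integrable setT (EFin \o (fun x => h x * b (dot x t))).
Proof.
move=> ih cb b1; have mh : measurable_fun setT h.
  by have /measurable_EFinP := measurable_int _ ih.
apply: (le_integrable measurableT _ _ ih).
  apply: measurable_funEFin; apply: measurable_funM => //.
  under eq_fun do rewrite dotC.
  by apply: (measurableT_comp _ (measurable_dot t)); exact: continuous_measurable_fun.
by move=> x _; rewrite /= lee_fin normrM ler_piMr.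
Qed.

Lemma normr_dot_le x y (c : R) : (forall i, `|x ord0 i| <= c) ->
  `|dot x y| <= c * \sum_i `|y ord0 i|.
Proof.
move=> xc; rewrite (le_trans (ler_norm_sum _ _ _))// mulr_sumr.
by apply: ler_sum => i _; rewrite normrM ler_wpM2r.
Qed.

End dot_theory.

Section refinement.
Context {R : realType} (n N T : nat).
Local Open Scope complex_scope.
Local Notation normc := (@ComplexField.Normc.normc R).
Local Notation V := 'rV[R]_n.
Local Notation mu := (@lebesgue_rV R n).
Hypotheses (N0 : (0 < N)%N) (T0 : (0 < T)%N).

Definition prod_fejer (a : R) (x : V) : R := \prod_i fejer (a * x ord0 i).

Lemma prod_fejer_ge0 a x : 0 <= prod_fejer a x.
Proof. by apply: prodr_ge0 => i _; exact: fejer_ge0. Qed.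

Lemma prod_fejer_le1 a x : prod_fejer a x <= 1.
Proof.
apply: prodr_ile1 => i _; rewrite fejer_ge0/=.
by rewrite (le_trans (fejer_le_half _))// invf_le1// ler1n.
Qed.

Lemma measurable_prod_fejer a : measurable_fun setT (prod_fejer a).
Proof.
apply: (@measurable_prod_rV R n (fun s => fejer (a * s))).
exact: measurable_fejer_scale.
Qed.

Definition fejer_mass : R := \int[lebesgue_measure]_s fejer s.

Lemma fejer_mass_ge0 : 0 <= fejer_mass.
Proof. by apply: Rintegral_ge0 => s _; exact: fejer_ge0. Qed.

Lemma integral_prod_fejer a : 0 < a ->
  (\int[mu]_x (prod_fejer a x)%:E = ((a^-1 * fejer_mass) ^+ n)%:E)%E.
Proof.
move=> a0; apply: (ge0_integral_prod_rV n (k := fun s => fejer (a * s))).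
- exact: measurable_fejer_scale.
- by move=> s; exact: fejer_ge0.
- rewrite integral_fejer_scale// EFin_Rintegral//; exact: integrable_fejer.
Qed.

(** For each coordinate, the two indices of a term of the polynomial in
    [fejer_refine]; the exponents of that term are their differences. *)
Definition digit := {ffun 'I_n -> 'I_N * 'I_N}.

Definition digit_vec (j : digit) : V :=
  \row_i ((j i).1%:R - (j i).2%:R).

Lemma normr_digit_vec (j : digit) i : `|digit_vec j ord0 i| <= N%:R - 1.
Proof.
rewrite mxE; case: (j i) => [[a aN] [b bN]] /=.
have h k : (k < N)%N -> (0 <= k%:R :> R) && (k%:R <= N%:R - 1 :> R).
  move=> kN; rewrite ler0n/= lerBrDr natr1 ler_nat//.
have /andP[? ?] := h a aN; have /andP[? ?] := h b bN.
by rewrite ler_norml; apply/andP; split; lra.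
Qed.

Lemma card_digit : #|{: digit}| = ((N * N) ^ n)%N.
Proof. by rewrite card_ffun card_prod !card_ord. Qed.

Lemma card_digit_gt0 : (0 < #|{: digit}|)%N.
Proof. by rewrite card_digit expn_gt0 muln_gt0 N0. Qed.

(** The product of the polynomials of [fejer_refine], expanded: the kernel at
    scale N r is the kernel at scale r times a mean of exponentials. *)
Lemma prod_fejer_refine r x : (prod_fejer (N%:R * r) x)%:C =
  (prod_fejer r x)%:C * ((#|{: digit}|%:R^-1)%:C *
    \sum_(j : digit) cis (r * dot (digit_vec j) x)).
Proof.
rewrite /prod_fejer !rmorph_prod/=.
under eq_bigr do rewrite -mulrA fejer_refine//.
rewrite big_split/= big_split/=; congr (_ * (_ * _)).
  rewrite prodr_const card_ord card_digit.
  by rewrite -rmorphXn/= exprVn natrX natrM expr2.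
rewrite bigA_distr_bigA/=; apply: eq_bigr => j _.
rewrite -cis_sum; congr cis; rewrite /dot mulr_sumr; apply: eq_bigr => i _.
by rewrite mxE mulrCA.
Qed.

Definition child (r : R) (d : V) (j : digit) : V := d + r *: digit_vec j.

Definition exp_sum (D : seq V) (x : V) : R[i] := \sum_(d <- D) cis (dot d x).

Definition scale (k : nat) : R := N%:R ^- k.

Lemma scale_gt0 k : 0 < scale k.
Proof. by rewrite invr_gt0 exprn_gt0// ltr0n. Qed.

Lemma scaleS k : scale k = N%:R * scale k.+1.
Proof.
have Nn0 : N%:R != 0 :> R by rewrite pnatr_eq0 -lt0n.
by rewrite /scale exprS invfM mulrA divff// mul1r.
Qed.

Definition approx (k : nat) (D : seq V) (x : V) : R[i] :=
  (T%:R ^- k * prod_fejer (scale k) x)%:C * exp_sum D x.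

(** Each frequency is listed T times, once for each of the T children that
    replace it. *)
Definition repeated (D : seq V) : seq V := flatten [seq nseq T d | d <- D].

Lemma size_repeated D : size (repeated D) = (T * size D)%N.
Proof.
rewrite size_flatten /shape -map_comp.
rewrite (eq_map (g := fun=> T)); last by move=> d /=; rewrite size_nseq.
by elim: D => [|d D IH] /=; rewrite ?muln0// IH mulnS.
Qed.

Lemma sum_repeated (D : seq V) (F : V -> R[i]) :
  \sum_(d <- repeated D) F d = T%:R * \sum_(d <- D) F d.
Proof.
rewrite big_flatten big_map mulr_sumr; apply: eq_bigr => d _.
by rewrite big_nseq iter_addr addr0 mulr_natl.
Qed.

Section step.
Variables (k : nat) (D : seq V).
Let r := scale k.+1.
Let e (d : V) (j : digit) (x : V) : R[i] := cis (dot (child r d j) x).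

Let cmeasurable_e d j : cmeasurable (e d j).
Proof. by apply: cmeasurable_cis; exact: measurable_dot. Qed.

Let normc_e d j x : normc (e d j x) <= 1.
Proof. by rewrite normc_cis. Qed.

Let children (js : seq digit) : seq V :=
  [seq child r q.1 q.2 | q <- zip (repeated D) js].

Let error (js : seq digit) (x : V) : R[i] :=
  \sum_(q <- zip (repeated D) js) centered e q.1 q.2 x.

(** By [prod_fejer_refine], approx k D is the mean of approx k.+1 over all the
    choices of children. Subtracting it leaves the centered waves. *)
Let approx_sub js x : size js = size (repeated D) ->
  approx k.+1 (children js) x - approx k D x =
  (T%:R ^- k.+1 * prod_fejer r x)%:C * error js x.
Proof.
move=> sjs; rewrite /error /centered sumrB mulrBr; congr (_ - _).
  by rewrite /approx /exp_sum big_map.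
have -> : \sum_(q <- zip (repeated D) js)
    (#|{: digit}|%:R^-1)%:C * \sum_(j : digit) e q.1 j x =
    \sum_(d <- repeated D) (#|{: digit}|%:R^-1)%:C * \sum_(j : digit) e d j x.
  rewrite -[in RHS](unzip1_zip (s := repeated D) (t := js)) ?sjs//.
  by rewrite big_map.
rewrite sum_repeated /approx scaleS.
have He d : \sum_(j : digit) e d j x =
    cis (dot d x) * \sum_(j : digit) cis (r * dot (digit_vec j) x).
  rewrite mulr_sumr; apply: eq_bigr => j _.
  by rewrite /e /child dotDl dotZl cisD.
have Tn0 : T%:R != 0 :> R by rewrite pnatr_eq0 -lt0n.
under [in RHS]eq_bigr do rewrite He mulrCA.
rewrite -mulr_suml rmorphM/= prod_fejer_refine -/r -/(exp_sum D x).
rewrite [in RHS]rmorphM/= exprS invfM rmorphM/=.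
have -> : T%:R = (T%:R : R)%:C :> R[i] by rewrite rmorph_nat.
have : (T%:R^-1)%:C * (T%:R)%:C = 1 :> R[i] by rewrite -rmorphM mulVf.
set t := (T%:R^-1)%:C; set t' := (T%:R)%:C => tt.
set c := (_ ^- k)%:C; set p := (prod_fejer r x)%:C; set q := (_ * \sum_j _).
set E := exp_sum D x.
transitivity ((t * t') * (c * p * q * E)); last by ring.
by rewrite tt mul1r; ring.
Qed.

(** Near the origin the waves of all the children of d are close to each
    other. This bound gives the pointwise convergence of the f_k. *)
Lemma normc_centered_le d j x :
  normc (centered e d j x) <= 4 * scale k * \sum_i `|x ord0 i|.
Proof.
have Cn0 : #|{: digit}|%:R != 0 :> R by rewrite pnatr_eq0 -lt0n card_digit_gt0.
have -> : centered e d j x =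
    (#|{: digit}|%:R^-1)%:C * \sum_(l : digit) (e d j x - e d l x).
  rewrite sumrB mulrBr sumr_const -[e d j x *+ _]mulr_natl mulrA.
  rewrite -(rmorph_nat (real_complex R)) -rmorphM/= mulVf// mul1r//.
rewrite ComplexField.Normc.normcM normc_real ger0_norm ?invr_ge0//.
rewrite mulrC ler_pdivrMr ?ltr0n ?card_digit_gt0//.
rewrite (le_trans (normc_sum_le _ _))// mulrC.
have b l : normc (e d j x - e d l x) <= 4 * scale k * \sum_i `|x ord0 i|.
  rewrite (le_trans (normr_cis_sub_le _ _))// -dotBl.
  have -> : child r d j - child r d l = r *: (digit_vec j - digit_vec l).
    by rewrite /child opprD addrACA subrr add0r scalerBr.
  rewrite dotZl normrM gtr0_norm ?scale_gt0//.
  have h : `|dot (digit_vec j - digit_vec l) x| <= 2 * N%:R * \sum_i `|x ord0 i|.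
    apply: normr_dot_le => i; rewrite !mxE.
    rewrite (le_trans (ler_normB _ _))//.
    have := normr_digit_vec j i; have := normr_digit_vec l i; rewrite !mxE.
    lra.
  rewrite (scaleS k) -/r; have r0 : 0 < r by exact: scale_gt0.
  have := ler_wpM2l (ltW r0) h; lra.
rewrite (le_trans (ler_sum _ (fun l _ => b l)))// sumr_const.
by rewrite -[leLHS]mulr_natl mulrC.
Qed.

Hypothesis sD : size D = (T ^ k)%N.

Let size_zip_repeated (js : seq digit) : size js = size (repeated D) ->
  size (zip (repeated D) js) = (T ^ k.+1)%N.
Proof. by move=> sjs; rewrite size_zip sjs minnn size_repeated sD expnS. Qed.

Lemma normc_sub_approx_le js x : size js = size (repeated D) ->
  normc (approx k.+1 (children js) x - approx k D x) <=
  4 * scale k * \sum_i `|x ord0 i|.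
Proof.
move=> sjs; rewrite approx_sub// ComplexField.Normc.normcM normc_real.
have Tk : 0 < T%:R ^+ k.+1 :> R by rewrite exprn_gt0// ltr0n.
rewrite ger0_norm ?mulr_ge0 ?prod_fejer_ge0 ?invr_ge0 ?(ltW Tk)//.
have B0 : 0 <= 4 * scale k * \sum_i `|x ord0 i|.
  by rewrite !mulr_ge0 ?(ltW (scale_gt0 k))// sumr_ge0.
have h : normc (error js x) <= T%:R ^+ k.+1 * (4 * scale k * \sum_i `|x ord0 i|).
  rewrite (le_trans (normc_sum_le _ _))//.
  rewrite (le_trans (ler_sum _ (fun q _ => normc_centered_le q.1 q.2 x)))//.
  by rewrite big_const_seq count_predT size_zip_repeated// iter_addr addr0 -natrX -[leLHS]mulr_natl.
rewrite -[leLHS]mulrA ler_pdivrMl//.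
by rewrite (le_trans _ h)// ler_piMl ?normc_ge0// prod_fejer_le1.
Qed.

Variable p : R.
Hypothesis p1 : 1 <= p.

(** The powers of N and T in the ratio are the mass of the kernel and the
    square root cancellation in the sum of the centered waves. *)
Definition step_const : R :=
  (8 * p) `^ p * (4 * expR 1 * fejer_mass ^+ n).

Definition step_ratio : R := N%:R ^+ n * T%:R `^ (- (p / 2)).

(* The inverse of the typical size of a sum of T^(k+1) waves: with this value,
   growth to the power T^(k+1) stays bounded. The factor 4 ensures
   2 * lam <= 1/2. *)
Let lam : R := (4 * Num.sqrt (T ^ k.+1)%:R)^-1.

(** With lam as above, [greedy_selection] bounds the integral of
    W * pot(lam * error) by a constant times the mass of W, and the potential
    dominates the p-th power of the modulus. *)
Lemma refine_step : exists D', [/\ size D' = (T ^ k.+1)%N,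
  forall d' : V, d' \in D' -> exists2 d : V, d \in D &
    forall i, `|d' ord0 i - d ord0 i| <= scale k - scale k.+1,
  forall x, normc (approx k.+1 D' x - approx k D x) <=
    4 * scale k * \sum_i `|x ord0 i| &
  (\int[mu]_x (normc (approx k.+1 D' x - approx k D x) `^ p)%:E <=
   (step_const * step_ratio ^+ k.+1)%:E)%E].
Proof.
set M : R := (T ^ k.+1)%:R.
have M1 : 1 <= M by rewrite ler1n expn_gt0 T0.
have M0 : 0 < M by rewrite (lt_le_trans _ M1).
have sM1 : 1 <= Num.sqrt M by rewrite -sqrtr1 ler_wsqrtr.
have sM0 : 0 < Num.sqrt M by rewrite (lt_le_trans _ sM1).
have lam0 : 0 < lam by rewrite invr_gt0 mulr_gt0.
have lam2 : 2 * lam <= 2^-1.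
  rewrite /lam -/M invfM mulrA.
  have : (Num.sqrt M)^-1 <= 1 by rewrite invf_le1.
  lra.
have p0 : 0 <= p by rewrite (le_trans _ p1).
have [js sjs jsP] := greedy_selection cmeasurable_e normc_e
  card_digit_gt0 (measurable_prod_fejer r) (prod_fejer_ge0 r) (ltW lam0) lam2
  (repeated D).
exists (children js); split.
- by rewrite size_map size_zip_repeated.
- move=> _ /mapP[[d j] dj ->]; exists d.
    have : d \in repeated D.
      rewrite -(unzip1_zip (s := repeated D) (t := js)) ?sjs//.
      by apply/mapP; exists (d, j).
    by move=> /flattenP[_ /mapP[d' d'D ->] /nseqP[->]].
  move=> i; rewrite !mxE/= addrAC subrr add0r.
  have r0 : 0 < r by exact: scale_gt0.
  have := normr_digit_vec j i; rewrite mxE normrM (gtr0_norm r0) => h.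
  rewrite (scaleS k) -/r.
  have := ler_wpM2l (ltW r0) h; lra.
- by move=> x; exact: normc_sub_approx_le.
(* K bounds the p-th power of an increment by the integrand of the greedy
   selection: M^-1 comes from the normalization of the sums, lam^-1 from the
   scaling inside pot. *)
pose K := (M^-1 * lam^-1) `^ p * (2 * p) `^ p.
have K0 : 0 <= K by rewrite mulr_ge0 ?powR_ge0.
have mE : measurable_fun setT (fun x => prod_fejer r x *
    pot (lam%:C * error js x)).
  apply: measurable_funM; first exact: measurable_prod_fejer.
  have [m1 m2] : cmeasurable (fun x => lam%:C * error js x).
    apply: cmeasurableM; first exact: cmeasurable_cst.
    by apply: cmeasurable_sum => q; exact: cmeasurable_centered.
  apply: measurable_funD; apply: measurable_funD;
    by apply: (measurableT_comp (@measurable_expR R)) => //; exact: measurableT_comp.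
have bound x : normc (approx k.+1 (children js) x - approx k D x) `^ p <=
    K * (prod_fejer r x * pot (lam%:C * error js x)).
  rewrite approx_sub// ComplexField.Normc.normcM normc_real -natrX -/M.
  have W0 := prod_fejer_ge0 r x; have W1 := prod_fejer_le1 r x.
  rewrite ger0_norm ?mulr_ge0 ?invr_ge0 ?(ltW M0)//.
  have -> : normc (error js x) = lam^-1 * normc (lam%:C * error js x).
    by rewrite ComplexField.Normc.normcM normc_real gtr0_norm// mulKf// gt_eqF.
  set S := lam%:C * _.
  have -> : M^-1 * prod_fejer r x * (lam^-1 * normc S) =
     (M^-1 * lam^-1) * (prod_fejer r x * normc S) by ring.
  rewrite powRM ?mulr_ge0 ?invr_ge0 ?normc_ge0 ?(ltW M0) ?(ltW lam0)//.
  rewrite /K -mulrA ler_wpM2l ?powR_ge0// powRM ?normc_ge0// [leRHS]mulrCA.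
  (* It remains to see that W^p <= W, as W lies in [0, 1]. *)
  rewrite ler_pM ?powR_ge0 ?normc_powR_le_pot//.
  have [->|Wn0] := eqVneq (prod_fejer r x) 0.
    by rewrite powR0// gt_eqF// (lt_le_trans _ p1).
  by rewrite ge1r_powR// lt_neqAle eq_sym Wn0 W0.
have mdiff : measurable_fun setT
    (fun x => normc (approx k.+1 (children js) x - approx k D x) `^ p).
  apply: (@measurableT_comp _ _ _ _ _ _ (fun t : R => t `^ p)).
    exact: measurable_powR.
  apply: measurable_normc.
  under eq_fun do rewrite approx_sub//.
  apply: cmeasurableM.
    apply: cmeasurable_real; apply: measurable_funM => //.
    exact: measurable_prod_fejer.
  by apply: cmeasurable_sum => q; exact: cmeasurable_centered.
apply: (@le_trans _ _ (\int[mu]_x (K * (prod_fejer r x *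
    pot (lam%:C * error js x)))%:E)%E).
  apply: ge0_le_integral => //.
  - by move=> x _; rewrite lee_fin powR_ge0.
  - exact: measurable_funEFin.
  - by apply: measurable_funEFin; exact: measurable_funM.
  - by move=> x _; rewrite lee_fin.
under eq_integral do rewrite EFinM.
rewrite ge0_integralZl_EFin//; last 2 first.
- by move=> x _; rewrite lee_fin mulr_ge0 ?prod_fejer_ge0 ?pot_ge0.
- exact: measurable_funEFin.
rewrite (le_trans (lee_wpmul2l _ jsP)) ?lee_fin//.
rewrite integral_prod_fejer ?scale_gt0// size_repeated sD -expnS.
rewrite -!EFinM lee_fin.
have sM2 : Num.sqrt M ^+ 2 = M by rewrite sqr_sqrtr// ltW.
have sMn0 : Num.sqrt M != 0 by rewrite gt_eqF.
have KE : K = (8 * p) `^ p * (T%:R `^ (- (p / 2))) ^+ k.+1.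
  rewrite /K /lam invrK -/M -powRM ?mulr_ge0 ?invr_ge0 ?(ltW M0) ?(ltW sM0)//.
  have -> : M^-1 * (4 * Num.sqrt M) * (2 * p) = (8 * p) * (Num.sqrt M)^-1.
    by rewrite -[in M^-1]sM2; field.
  rewrite powRM ?mulr_ge0 ?invr_ge0 ?(ltW sM0)//; congr *%R.
  rewrite -powR12_sqrt ?(ltW M0)// -powRN -powRrM.
  rewrite -powR_mulrn ?powR_ge0// -[RHS]powRrM [in RHS]mulrC [RHS]powRrM.
  rewrite powR_mulrn// -natrX -/M; congr (_ `^ _); by field.
(* The exponent is 2 (2 lam)^2 T^(k+1) = 1/2. *)
have growthE : expR (2 * (2 * lam) ^+ 2) ^+ (T ^ k.+1) <= expR 1.
  rewrite -expRM_natl ler_expR -/M /lam -/M exprMn exprVn exprMn sM2.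
  have -> : M * (2 * (2 ^+ 2 * (4 ^+ 2 * M)^-1)) = 2^-1.
    by field; rewrite gt_eqF.
  by rewrite invf_le1// ler1n.
have rE : r^-1 = N%:R ^+ k.+1 by rewrite invrK.
rewrite KE /step_const /step_ratio rE exprMn !exprMn -!exprM [(n * _)%N]mulnC.
set a := (8 * p) `^ p; set b := (_ `^ _) ^+ _; set c := N%:R ^+ _.
set J := fejer_mass ^+ n; rewrite [leRHS](_ : _ = a * b * (4 * expR 1 * (c * J))); last by ring.
rewrite ler_wpM2l ?mulr_ge0 ?powR_ge0 ?exprn_ge0 ?powR_ge0//.
rewrite ler_wpM2r ?mulr_ge0 ?exprn_ge0 ?fejer_mass_ge0//.
by rewrite -[2 ^+ 2 * _]exprMn ler_wpM2l.
Qed.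

End step.

End refinement.

(** * The limit function *)

Section Lnorm_bounds.
Local Open Scope ereal_scope.
Context d (X : measurableType d) (R : realType).
Variable (m : {measure set X -> \bar R}).

Lemma Lnorm_ge0_le (g : X -> R) (p b : R) : (1 <= p)%R -> (0 <= b)%R ->
  (forall x, (0 <= g x)%R) ->
  ('N[m]_p%:E[EFin \o g] <= b%:E) = (\int[m]_x ((g x) `^ p)%:E <= (b `^ p)%:E).
Proof.
move=> p1 b0 g0; have p0 : (0 < p)%R by exact: lt_le_trans p1.
have E : \int[m]_x `|(EFin \o g) x| `^ p = \int[m]_x ((g x) `^ p)%:E.
  by apply: eq_integral => x _; rewrite /= ger0_norm.
rewrite unlock E.
have : 0 <= \int[m]_x ((g x) `^ p)%:E.
  by apply: integral_ge0 => x _; rewrite lee_fin powR_ge0.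
case: (\int[m]_x _) => [r|_|//]; last first.
  by rewrite poweRyr ?invr_neq0 ?gt_eqF// !leye_eq.
rewrite lee_fin => r0; rewrite poweR_EFin !lee_fin.
have -> : r = ((r `^ p^-1) `^ p)%R by rewrite -powRrM mulVf ?gt_eqF// powRr1.
have s0 : (0 <= r `^ p^-1)%R by exact: powR_ge0.
set s := (r `^ p^-1)%R in s0 *.
have -> : ((s `^ p) `^ p^-1)%R = s by rewrite -powRrM mulfV ?gt_eqF// powRr1.
apply/idP/idP => h; first exact: (ge0_ler_powR (ltW p0)).
rewrite leNgt; apply/negP => bs.
have := gt0_ltr_powR p0 b0 s0 bs; rewrite ltNge.
by rewrite h.
Qed.

End Lnorm_bounds.

Lemma is_cvg_geometric_increments (R : realType) (u : R^nat) (B z : R) :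
  0 <= B -> 0 <= z < 1 -> (forall k, `|u k.+1 - u k| <= B * z ^+ k) -> cvgn u.
Proof.
move=> B0 /andP[z0 z1] uB.
have -> : u = (fun k => series (telescope u) k + u 0%N).
  by apply/funext => k; rewrite telescopeK/= subrK.
apply: is_cvgD; last exact: is_cvg_cst.
apply: normed_cvg.
apply: (@series_le_cvg _ _ (geometric B z)) => //=.
- by move=> k; rewrite mulr_ge0 ?exprn_ge0.
- by apply: is_cvg_geometric_series; rewrite ger0_norm.
Qed.

Lemma cvg_powR (R : realType) (u : R^nat) (l p : R) : 1 <= p -> 0 <= l ->
  (forall k, 0 <= u k <= 1) -> u k @[k --> \oo] --> l ->
  u k `^ p @[k --> \oo] --> l `^ p.
Proof.
move=> p1 l0 u01 ul; have p0 : 0 < p by exact: lt_le_trans p1.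
(* The power function need not be differentiable at 0; there u^p <= u since
   u <= 1. *)
have [l00|ln0] := eqVneq l 0.
  rewrite l00 powR0 ?gt_eqF//; rewrite l00 in ul.
  apply: (squeeze_cvgr _ (cvg_cst 0) ul); apply: nearW => k.
  rewrite powR_ge0/=; have /andP[a b] := u01 k.
  have [->|un0] := eqVneq (u k) 0; first by rewrite powR0// gt_eqF.
  by rewrite ge1r_powR// lt_neqAle eq_sym un0 a.
have cp : {for l, continuous (fun t : R => t `^ p)}; last exact: cvg_comp ul cp.
apply/differentiable_continuous/derivable1_diffP/derivable_powR.
by rewrite in_itv/= andbT lt_neqAle eq_sym ln0.
Qed.

Lemma measurable_powRf d (X : measurableType d) (R : realType) (f : X -> R)
  (p : R) : measurable_fun setT f -> measurable_fun setT (fun x => f x `^ p).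
Proof.
by move=> mf; apply: (@measurableT_comp _ _ _ _ _ _ (fun t : R => t `^ p)).
Qed.

Section sequence.
Context {R : realType} (n N T : nat) (p : R).
Local Open Scope complex_scope.
Local Notation normc := (@ComplexField.Normc.normc R).
Local Notation V := 'rV[R]_n.
Local Notation mu := (@lebesgue_rV R n).
Hypotheses (N1 : (1 < N)%N) (T0 : (0 < T)%N) (p1 : 1 <= p).

(** The refinement step, iterated from the single frequency 0. *)
Lemma refine_sequence : exists D : nat -> seq V, [/\ D 0%N = [:: 0],
  forall k, size (D k) = (T ^ k)%N,
  forall k (d' : V), d' \in D k.+1 -> exists2 d : V, d \in D k &
    forall i, `|d' ord0 i - d ord0 i| <= scale N k - scale N k.+1,
  forall k x, normc (approx N T k.+1 (D k.+1) x - approx N T k (D k) x) <=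
    4 * scale N k * \sum_i `|x ord0 i| &
  forall k, (\int[mu]_x
     (normc (approx N T k.+1 (D k.+1) x - approx N T k (D k) x) `^ p)%:E <=
   (step_const n p * step_ratio n N T p ^+ k.+1)%:E)%E].
Proof.
(* The size of the current set is a premise inside the existential, so that
   the choice of the next set is a total function. *)
have next (kD : nat * seq V) : exists D', size kD.2 = (T ^ kD.1)%N ->
    [/\ size D' = (T ^ kD.1.+1)%N,
  forall d' : V, d' \in D' -> exists2 d : V, d \in kD.2 &
    forall i, `|d' ord0 i - d ord0 i| <= scale N kD.1 - scale N kD.1.+1,
  forall x, normc (approx N T kD.1.+1 D' x - approx N T kD.1 kD.2 x) <=
    4 * scale N kD.1 * \sum_i `|x ord0 i| &
  (\int[mu]_x (normc (approx N T kD.1.+1 D' x - approx N T kD.1 kD.2 x) `^ p)%:E <=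
   (step_const n p * step_ratio n N T p ^+ kD.1.+1)%:E)%E].
  have [sD|sD] := pselect (size kD.2 = (T ^ kD.1)%N); last by exists [::].
  by have [D' ?] := refine_step (ltnW N1) T0 sD p1; exists D'.
have [F FP] := choice next.
pose D := fix D k := if k is k'.+1 then F (k', D k') else [:: 0 : V].
have sD k : size (D k) = (T ^ k)%N.
  by elim: k => [//|k IH]; have [] := FP (k, D k) IH.
exists D; split => // k; first by move=> d'; have [_ + _ _] := FP (k, D k) (sD k); exact.
- by move=> x; have [_ _ + _] := FP (k, D k) (sD k); exact.
- by have [_ _ _ +] := FP (k, D k) (sD k); exact.
Qed.

Variable D : nat -> seq V.
Hypothesis D0 : D 0%N = [:: 0].
Hypothesis sD : forall k, size (D k) = (T ^ k)%N.
Hypothesis Dnested : forall k (d' : V), d' \in D k.+1 ->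
  exists2 d : V, d \in D k &
    forall i, `|d' ord0 i - d ord0 i| <= scale N k - scale N k.+1.
Hypothesis Dincr : forall k x,
  normc (approx N T k.+1 (D k.+1) x - approx N T k (D k) x) <=
    4 * scale N k * \sum_i `|x ord0 i|.
Hypothesis DLp : forall k, (\int[mu]_x
     (normc (approx N T k.+1 (D k.+1) x - approx N T k (D k) x) `^ p)%:E <=
   (step_const n p * step_ratio n N T p ^+ k.+1)%:E)%E.

Let f_ k := approx N T k (D k).

Lemma cmeasurable_approx k : cmeasurable (approx N T k (D k)).
Proof.
apply: cmeasurableM.
  apply: cmeasurable_real; apply: measurable_funM => //.
  exact: measurable_prod_fejer.
apply: cmeasurable_sum => d; apply: cmeasurable_cis; exact: measurable_dot.
Qed.

Lemma normc_approx_le1 k x : normc (approx N T k (D k) x) <= 1.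
Proof.
rewrite ComplexField.Normc.normcM normc_real.
have Tk : 0 < T%:R ^+ k :> R by rewrite exprn_gt0// ltr0n.
rewrite ger0_norm ?mulr_ge0 ?invr_ge0 ?(ltW Tk) ?prod_fejer_ge0//.
rewrite -[leLHS]mulrA ler_pdivrMl// mulr1.
have h : normc (exp_sum (D k) x) <= T%:R ^+ k.
  rewrite (le_trans (normc_sum_le _ _))//.
  under eq_bigr do rewrite normc_cis.
  by rewrite big_const_seq count_predT iter_addr addr0 sD natrX.
by rewrite (le_trans _ h)// ler_piMl ?normc_ge0// prod_fejer_le1.
Qed.

Definition limit_fun (x : V) : R[i] :=
  limn (fun k => complex.Re (f_ k x)) +i* limn (fun k => complex.Im (f_ k x)).

Let scale_exp k : scale N k = (N%:R^-1 : R) ^+ k.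
Proof. by rewrite /scale exprVn. Qed.

Let N_ratio : 0 <= (N%:R^-1 : R) < 1.
Proof.
have N0 : 0 < N%:R :> R by rewrite ltr0n ltnW.
by rewrite invr_ge0 ltW// invf_lt1// ltr1n.
Qed.

Lemma cvg_Re_approx x :
  complex.Re (f_ k x) @[k --> \oo] --> complex.Re (limit_fun x).
Proof.
apply: (@is_cvg_geometric_increments _ _ (4 * \sum_i `|x ord0 i|) N%:R^-1) => //.
  by rewrite mulr_ge0// sumr_ge0.
move=> k; rewrite -cReN -cReD (le_trans (normr_Re_le _))//.
by rewrite (le_trans (Dincr k x))// scale_exp mulrAC.
Qed.

Lemma cvg_Im_approx x :
  complex.Im (f_ k x) @[k --> \oo] --> complex.Im (limit_fun x).
Proof.
apply: (@is_cvg_geometric_increments _ _ (4 * \sum_i `|x ord0 i|) N%:R^-1) => //.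
  by rewrite mulr_ge0// sumr_ge0.
move=> k; rewrite -cImN -cImD (le_trans (normr_Im_le _))//.
by rewrite (le_trans (Dincr k x))// scale_exp mulrAC.
Qed.

Lemma cmeasurable_limit_fun : cmeasurable limit_fun.
Proof.
split.
- apply: (measurable_fun_cvg (h := fun k x => complex.Re (f_ k x))) => [k|x _].
    by have [] := cmeasurable_approx k.
  exact: cvg_Re_approx.
- apply: (measurable_fun_cvg (h := fun k x => complex.Im (f_ k x))) => [k|x _].
    by have [] := cmeasurable_approx k.
  exact: cvg_Im_approx.
Qed.

Lemma cvg_normc_approx x : normc (f_ k x) @[k --> \oo] --> normc (limit_fun x).
Proof.
under eq_fun do rewrite normc_sqrtE; rewrite normc_sqrtE.
apply: continuous_cvg; first exact: sqrt_continuous.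
apply: cvgD; rewrite expr2; under eq_fun do rewrite expr2.
- apply: cvgM; exact: cvg_Re_approx.
- apply: cvgM; exact: cvg_Im_approx.
Qed.

Hypothesis ratio1 : step_ratio n N T p < 1.

Let ratio0 : 0 <= step_ratio n N T p.
Proof. by rewrite mulr_ge0 ?exprn_ge0// powR_ge0. Qed.

Let const0 : 0 <= step_const n p.
Proof.
by rewrite mulr_ge0 ?powR_ge0// mulr_ge0 ?exprn_ge0 ?fejer_mass_ge0// mulr_ge0 ?expR_ge0.
Qed.

Let Cp : R := step_const n p `^ p^-1.
Let rho : R := step_ratio n N T p `^ p^-1.

Let p0 : 0 < p. Proof. exact: lt_le_trans p1. Qed.

Let rho01 : 0 <= rho < 1.
Proof.
have ip : 0 < p^-1 by rewrite invr_gt0.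
have := gt0_ltr_powR ip ratio0 (@ler01 R) ratio1.
by rewrite powR1 powR_ge0.
Qed.

Let pVp : p^-1 * p = 1. Proof. by rewrite mulVf// gt_eqF. Qed.

Let base : R := (fejer_mass ^+ n) `^ p^-1.

(** Minkowski's inequality, summing the increments. *)
Let Lnorm_approx k : ('N[mu]_p%:E[EFin \o (fun x => normc (f_ k x))] <=
   (base + Cp * \sum_(j < k) rho ^+ j.+1)%:E)%E.
Proof.
elim: k => [|k IH].
  rewrite big_ord0 mulr0 addr0 Lnorm_ge0_le// ?powR_ge0//; last first.
    by move=> x; exact: normc_ge0.
  have -> : (base `^ p)%:E = (\int[mu]_x (prod_fejer (scale N 0) x)%:E)%E.
    have bE : base `^ p = fejer_mass ^+ n.
      rewrite /base -powRrM pVp powRr1//.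
      by rewrite exprn_ge0// fejer_mass_ge0.
    rewrite (integral_prod_fejer n (scale_gt0 (ltnW N1) 0)) bE.
    by rewrite /scale expr0 !invr1 mul1r.
  apply: ge0_le_integral => //.
  - by move=> x _; rewrite lee_fin powR_ge0.
  - apply: measurable_funEFin; apply: measurable_powRf.
    exact: measurable_normc (cmeasurable_approx 0).
  - by apply: measurable_funEFin; exact: measurable_prod_fejer.
  - move=> x _; rewrite lee_fin /f_ /approx D0 /exp_sum big_seq1.
    rewrite expr0 invr1 mul1r ComplexField.Normc.normcM normc_cis mulr1.
    rewrite normc_real ger0_norm ?prod_fejer_ge0//.
    have [->|Wn0] := eqVneq (prod_fejer (scale N 0) x) 0.
      by rewrite powR0// gt_eqF.
    by rewrite ge1r_powR// lt_neqAle eq_sym Wn0 prod_fejer_ge0 prod_fejer_le1.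
rewrite big_ord_recr/= mulrDr addrA.
set b := (X in (X + _)%:E); have b0 : 0 <= b.
  by rewrite addr_ge0 ?mulr_ge0 ?powR_ge0// sumr_ge0// => j _; rewrite exprn_ge0 ?powR_ge0.
have c0 : 0 <= Cp * rho ^+ k.+1 by rewrite mulr_ge0 ?exprn_ge0 ?powR_ge0.
have mfk j := measurable_normc (cmeasurable_approx j).
have mdiff : measurable_fun setT (fun x => normc (f_ k.+1 x - f_ k x)).
  apply: measurable_normc; apply: cmeasurableD; first exact: cmeasurable_approx.
  by apply: cmeasurableN; exact: cmeasurable_approx.
pose g x := normc (f_ k x) + normc (f_ k.+1 x - f_ k x).
have g0 x : 0 <= g x by rewrite addr_ge0 ?normc_ge0.
have fk0 x : 0 <= normc (f_ k.+1 x) by exact: normc_ge0.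
have bc0 := addr_ge0 b0 c0.
have : ('N[mu]_p%:E[EFin \o g] <= (b + Cp * rho ^+ k.+1)%:E)%E.
  rewrite (le_trans (minkowski_EFin _ (mfk k) mdiff p1))// EFinD leeD//.
  rewrite Lnorm_ge0_le//; last by move=> x; exact: normc_ge0.
  rewrite (le_trans (DLp k))// lee_fin powRM ?exprn_ge0 ?powR_ge0//.
  rewrite /Cp -powRrM pVp powRr1//.
  rewrite -[rho ^+ _]powR_mulrn ?powR_ge0// powRAC.
  by rewrite /rho -[X in X `^ _]powRrM pVp powRr1// powR_mulrn.
rewrite (Lnorm_ge0_le mu p1 bc0 g0) (Lnorm_ge0_le mu p1 bc0 fk0).
apply: le_trans; apply: ge0_le_integral => //.
- by move=> x _; rewrite lee_fin powR_ge0.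
- by apply: measurable_funEFin; apply: (measurable_powRf p (mfk k.+1)).
- apply: measurable_funEFin; apply: (measurable_powRf p (f := g)).
  exact: (measurable_funD (mfk k) mdiff).
- move=> x _; rewrite lee_fin; apply: ge0_ler_powR; rewrite ?nnegrE ?(ltW p0)//.
  have E (z w : R[i]) : z = w + (z - w) by rewrite addrC subrK.
  by rewrite {1}(E (f_ k.+1 x) (f_ k x)); exact: le_normcD.
Qed.

Let Lbound : R := base + Cp * (rho / (1 - rho)).

Let Lnorm_approx_le k :
  (\int[mu]_x (normc (f_ k x) `^ p)%:E <= (Lbound `^ p)%:E)%E.
Proof.
have /andP[r0 r1] := rho01.
have L0 : 0 <= Lbound.
  by rewrite addr_ge0 ?powR_ge0// mulr_ge0 ?powR_ge0// divr_ge0// subr_ge0 ltW.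
rewrite -Lnorm_ge0_le//; last by move=> x; exact: normc_ge0.
rewrite (le_trans (Lnorm_approx k))// lee_fin lerD2l ler_wpM2l ?powR_ge0//.
under eq_bigr do rewrite exprS; rewrite -mulr_sumr ler_wpM2l//.
have := subrX1 rho k.
have r1' : 0 < 1 - rho by rewrite subr_gt0.
rewrite -div1r ler_pdivlMr//; have := exprn_ge0 k r0; nra.
Qed.

(** Fatou's lemma, with the bounds on the f_k. *)
Lemma memLp_limit_fun : memLp p limit_fun.
Proof.
split; first exact: cmeasurable_limit_fun.
have mp (g : V -> R[i]) : cmeasurable g ->
    measurable_fun setT (fun x => (normc (g x) `^ p)%:E).
  move=> mg; apply: measurable_funEFin.
  by apply: measurable_powRf; exact: measurable_normc.
suff : (\int[mu]_x (normc (limit_fun x) `^ p)%:E <= (Lbound `^ p)%:E)%E.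
  have /andP[r0 r1] := rho01.
  have L0 : 0 <= Lbound.
    by rewrite addr_ge0 ?powR_ge0// mulr_ge0 ?powR_ge0// divr_ge0// subr_ge0 ltW.
  rewrite -Lnorm_ge0_le//; last by move=> x; exact: normc_ge0.
  by move=> h; rewrite (le_lt_trans h)// ltry.
have cv x : (normc (f_ k x) `^ p)%:E @[k --> \oo] --> (normc (limit_fun x) `^ p)%:E.
  apply: cvg_EFin; first by apply: nearW.
  apply: cvg_powR => //; first exact: normc_ge0.
    by move=> k; rewrite normc_ge0 normc_approx_le1.
  exact: cvg_normc_approx.
have -> : (\int[mu]_x (normc (limit_fun x) `^ p)%:E =
    \int[mu]_x limn_einf (fun k => (normc (f_ k x) `^ p)%:E))%E.
  apply: eq_integral => x _.
  by have [] := cvg_limn_einf_sup (cv x).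
apply: le_trans (fatou mu measurableT (fun k => mp _ (cmeasurable_approx k)) _) _.
  by move=> k x _; rewrite lee_fin powR_ge0.
rewrite limn_einf_lim; apply: lime_le; first exact: is_cvg_einfs.
near=> k; apply: le_trans (Lnorm_approx_le k).
by apply: ereal_inf_lbound; exists k => //=.
Unshelve. all: by end_near.
Qed.

Lemma frequency_le k (d : V) i : d \in D k -> `|d ord0 i| <= 1 - scale N k.
Proof.
elim: k d => [|k IH] d.
  by rewrite D0 inE => /eqP ->; rewrite mxE normr0 /scale expr0 invr1 subrr.
move=> /Dnested[d' /IH h h'].
rewrite -(subrK (d' ord0 i) (d ord0 i)) (le_trans (ler_normD _ _))//.
have := h' i; lra.
Qed.

(* The box of this side at the origin has dot products with the frequencies,
   whose coordinates are at most 1, bounded by n * side <= 1. *)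
Let side : R := n.+1%:R^-1.

Let side_gt0 : 0 < side. Proof. by rewrite invr_gt0. Qed.

Let box : set V := [set x | forall i, 0 < x ord0 i <= side].

(** Each wave has real part at least 1/2 in the box, and the kernel is at least
    1/8 in each coordinate. *)
Let Re_approx_ge k x : box x -> 8^-1 ^+ n / 2 <= complex.Re (f_ k x).
Proof.
move=> bx; have Tk : 0 < T%:R ^+ k :> R by rewrite exprn_gt0// ltr0n.
have sk : 0 < scale N k :> R by rewrite scale_gt0// ltnW.
have sk1 : scale N k <= 1 :> R.
  by rewrite invf_le1 ?exprn_gt0 ?ltr0n 1?ltnW// exprn_ege1// ler1n ltnW.
have side1 : side <= 1 by rewrite invf_le1// ler1n.
rewrite /f_ /approx cReZ /exp_sum cRe_sum.
have W : 8^-1 ^+ n <= prod_fejer (scale N k) x.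
  rewrite -[n in leLHS]card_ord -prodr_const; apply: ler_prod => i _.
  rewrite invr_ge0/= ler0n/= fejer_ge_eighth//.
  have /andP[x0 x1] := bx i; rewrite mulr_gt0//=.
  by rewrite mulr_ile1// ?(ltW sk) ?(ltW x0)// (le_trans x1).
have C : T%:R ^+ k / 2 <= \sum_(d <- D k) complex.Re (cis (dot d x)).
  rewrite -natrX -(sD k) -sum1_size natr_sum mulr_suml.
  rewrite big_seq [leRHS]big_seq; apply: ler_sum => d dD /=.
  have h : `|dot d x| <= 1.
    rewrite (le_trans (normr_dot_le (c := 1) _ _))//.
      by move=> i; rewrite (le_trans (frequency_le i dD))// gerBl ltW.
    rewrite mul1r (le_trans (_ : _ <= \sum_(i < n) side))//.
      by apply: ler_sum => i _; have /andP[x0 x1] := bx i; rewrite gtr0_norm.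
    rewrite sumr_const card_ord -[leLHS]mulr_natl ler_pdivrMr// mul1r.
    by rewrite ler_nat.
  have := one_sub_cos_le (dot d x).
  have : dot d x ^+ 2 <= 1.
    by rewrite -[_ ^+ 2]ger0_norm ?sqr_ge0// normrX expr_le1.
  lra.
have W0 := prod_fejer_ge0 (scale N k) x.
apply: (@le_trans _ _ (T%:R ^- k * prod_fejer (scale N k) x * (T%:R ^+ k / 2))).
  have -> : T%:R ^- k * prod_fejer (scale N k) x * (T%:R ^+ k / 2) =
      prod_fejer (scale N k) x / 2.
    set t := T%:R ^+ k in Tk *; have tn0 : t != 0 by rewrite gt_eqF.
    by rewrite mulrA [t^-1 * _]mulrC mulfVK.
  by rewrite ler_wpM2r.
by rewrite ler_wpM2l// mulr_ge0// invr_ge0 ltW.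
Qed.

Let mbox : measurable box.
Proof.
have -> : box = \bigcap_(i in [set: 'I_n]) [set x : V | `]0, side]%classic (x ord0 i)].
  apply/seteqP; split => [x bx i _ /=|x bx i]; first by rewrite in_itv/=; exact: bx.
  by have := bx i I; rewrite /= in_itv.
apply: fin_bigcap_measurable; first exact: finite_finset.
move=> i _.
have := @measurable_coord_rV R n i measurableT _ (measurable_itv `]0, side]).
by rewrite setTI.
Qed.

Let mu_box : mu box = (side ^+ n)%:E.
Proof.
have mI : measurable_fun setT (\1_(`]0, side]%classic) : R -> R).
  exact: measurable_indic.
have I1 : (\int[lebesgue_measure]_s (\1_(`]0, side]%classic) s)%:E = side%:E :> \bar R)%E.
  rewrite integral_indic// setIT/= lebesgue_measure_itv/= lte_fin side_gt0.
  by rewrite -EFinB subr0.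
have I0 s : 0 <= \1_(`]0, side]%classic) s :> R by rewrite indicE ler0n.
rewrite -(ge0_integral_prod_rV n mI I0 I1).
transitivity (\int[mu]_x (\1_box x)%:E)%E.
  by rewrite integral_indic// setIT.
apply: eq_integral => x _; congr EFin.
rewrite indicE; case: (boolP (x \in box)) => xb.
  rewrite big1// => i _; rewrite indicE mem_set//=.
  by have := set_mem xb i; rewrite in_itv.
apply/esym/eqP; rewrite prodf_seq_eq0.
have [i xi] : exists i, ~~ (0 < x ord0 i <= side).
  apply: contrapT => /forallNP h; move: xb; rewrite notin_setE; apply => i.
  by apply: contrapT => /negP; exact: h.
apply/hasP; exists i; first exact: mem_index_enum.
by rewrite /= indicE memNset//= in_itv/=; exact/negP.
Qed.

Lemma limit_fun_neq0 : ~ {ae mu, forall x, limit_fun x = 0}.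
Proof.
move=> [Z [mZ Z0 subZ]].
have : (mu box <= mu Z)%E.
  apply: le_measure; rewrite ?inE// => x bx; apply: subZ => /= fx0.
  have : 8^-1 ^+ n / 2 <= complex.Re (limit_fun x).
    apply: (cvgr_to_ge (@cvg_Re_approx x)); apply: nearW => k.
    exact: Re_approx_ge.
  rewrite fx0/= leNgt => /negP; apply.
  by rewrite divr_gt0// exprn_gt0// invr_gt0.
by rewrite Z0 mu_box lee_fin leNgt exprn_gt0.
Qed.

End sequence.

(** * Decay of the Fourier transforms of test functions *)

Section pointwise_continuity.
Context {R : realType} {X Y : topologicalType}.
Implicit Types f g : X -> R.

Lemma continuous_addf f g : continuous f -> continuous g ->
  continuous (fun x => f x + g x).
Proof. by move=> cf cg x; exact: (cvgD (cf x) (cg x)). Qed.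

Lemma continuous_mulf f g : continuous f -> continuous g ->
  continuous (fun x => f x * g x).
Proof. by move=> cf cg x; exact: (cvgM (cf x) (cg x)). Qed.

Lemma continuous_compf (h : X -> Y) (u : Y -> R) : continuous h ->
  continuous u -> continuous (fun x => u (h x)).
Proof. by move=> ch cu x; exact: (continuous_comp (ch x) (cu (h x))). Qed.

End pointwise_continuity.

Section integral_derivative.
Context {R : realType}.
Local Notation leb := (@lebesgue_measure R).

(** The fundamental theorem of calculus on [-L, L]. *)
Lemma integral_derivative_eq0 (F f : R -> R) (L : R) : 0 < L ->
  (forall s : R, is_derive s (1 : R) F (f s)) -> continuous f ->
  (forall s, L <= `|s| -> F s = 0) -> (forall s, L <= `|s| -> f s = 0) ->
  (\int[leb]_s (f s)%:E = 0)%E.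
Proof.
move=> L0 dF cf F0 f0.
have cF : continuous F.
  by move=> s; apply/differentiable_continuous/derivable1_diffP; have [] := dF s.
have -> : (\int[leb]_s (f s)%:E = \int[leb]_(s in `[(- L)%R, L%R]) (f s)%:E)%E.
  rewrite [RHS]integral_mkcond; apply: eq_integral => s _.
  rewrite patchE; case: ifPn => //; rewrite notin_setE/= in_itv/= => /negP.
  by rewrite -ler_norml -ltNge => /ltW/f0 ->.
rewrite (@continuous_FTC2 _ f F).
- by rewrite !F0 ?subee// ?normrN ger0_norm// ltW.
- by lra.
- exact: continuous_subspaceT.
- split.
  + by move=> s _; have [] := dF s.
  + exact/cvg_at_right_filter/cF.
  + exact/cvg_at_left_filter/cF.
- by move=> s _; rewrite derive1E; have [] := dF s.
Qed.

End integral_derivative.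

Section weight.
Context {R : realType} {n : nat}.
Local Notation V := 'rV[R]_n.
Local Notation mu := (@lebesgue_rV R n).

(** An integrable function with a product structure, which dominates the
    Fourier transforms of test functions. *)
Definition weight (x : V) : R := \prod_i (1 + x ord0 i ^+ 2)^-1.

Lemma one_add_sqr_gt0 (s : R) : 0 < 1 + s ^+ 2.
Proof. by rewrite ltr_wpDr ?sqr_ge0. Qed.

Lemma weight_gt0 x : 0 < weight x.
Proof. by apply: prodr_gt0 => i _; rewrite invr_gt0 one_add_sqr_gt0. Qed.

Lemma measurable_weight : measurable_fun setT weight.
Proof. exact: (@measurable_prod_rV R n _ (@measurable_poisson R)). Qed.

Lemma integrable_weight : mu.-integrable setT (EFin \o weight).
Proof.
apply/integrableP; split; first exact: measurable_funEFin measurable_weight.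
under eq_integral => x _ do rewrite /= gtr0_norm ?weight_gt0//.
rewrite (@ge0_integral_prod_rV R n (fun s => (1 + s ^+ 2)^-1) pi) ?ltry//.
- exact: measurable_poisson.
- by move=> s; rewrite invr_ge0 ltW// one_add_sqr_gt0.
- exact: integral_poisson.
Qed.

Lemma le_weight_integrable (g : V -> R) (c : R) : measurable_fun setT g ->
  (forall x, `|g x| <= c * weight x) -> mu.-integrable setT (EFin \o g).
Proof.
move=> mg gc; apply: (le_integrable measurableT _ _
  (integrableZl measurableT c integrable_weight)).
  exact: measurable_funEFin.
by move=> x _; rewrite /= lee_fin (le_trans (gc x))// ler_norm.
Qed.

End weight.

Section bounded_support.
Context {R : realType} {n : nat}.
Local Notation V := 'rV[R]_n.
Local Notation mu := (@lebesgue_rV R n).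
Implicit Types g : V -> R.

Definition supp_in (M : R) g := forall (x : V) i, M < `|x ord0 i| -> g x = 0.

(** A continuous function is bounded on the cube of half-side M, and the weight
    is bounded below there. *)
Lemma supp_in_le_weight M g : 0 <= M -> continuous g -> supp_in M g ->
  exists c, forall x, `|g x| <= c * weight x.
Proof.
move=> M0 cg sg.
pose A := [set x : V | forall i, `[-M, M]%classic (x ord0 i)].
have cA : compact A.
  exact: (@rV_compact R n (fun=> `[-M, M]%classic) (fun=> @segment_compact R _ _)).
have A0 : A !=set0 by exists 0 => i; rewrite /= mxE in_itv/= oppr_le0 M0.
have cag : continuous (fun x => `|g x|).
  by move=> x; apply: continuous_comp; [exact: cg|exact: norm_continuous].
have [c _ cmax] := EVT_max_rV A0 cA (continuous_subspaceT cag).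
have w0 : 0 < (1 + M ^+ 2)^-1 ^+ n by rewrite exprn_gt0// invr_gt0 one_add_sqr_gt0.
exists (`|g c| / (1 + M ^+ 2)^-1 ^+ n) => x.
have [xA|/existsNP[i xi]] := pselect (A x).
  rewrite (le_trans (cmax x _)) ?inE// -mulrA ler_peMr// mulrC ler_pdivlMr// mul1r.
  rewrite -[n in leLHS]card_ord -prodr_const; apply: ler_prod => i _.
  rewrite invr_ge0 (ltW (one_add_sqr_gt0 _))/= lef_pV2 ?posrE ?one_add_sqr_gt0//.
  rewrite lerD2l -[leLHS]ger0_norm ?sqr_ge0// normrX lerXn2r ?nnegrE//.
  by have := xA i; rewrite /= in_itv/= -ler_norml.
rewrite (sg x i).
  by rewrite normr0 mulr_ge0 ?(ltW (weight_gt0 _))// divr_ge0// ltW.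
by move: xi; rewrite /= in_itv/= -ler_norml => /negP; rewrite -ltNge.
Qed.

Lemma integrable_supp_in M g : 0 <= M -> continuous g -> supp_in M g ->
  mu.-integrable setT (EFin \o g).
Proof.
move=> M0 cg sg; have [c gc] := supp_in_le_weight M0 cg sg.
by apply: (le_weight_integrable _ gc); exact: continuous_measurable_rV.
Qed.

Lemma supp_in_partial M g i : supp_in M g -> supp_in M (partial i g).
Proof.
move=> sg x j xj; rewrite /partial (@near_eq_derive _ _ _ g (cst 0)).
  exact: derive_cst.
have : \forall y \near x, M < `|(y : V) ord0 j|.
  have cj : {for x, continuous (fun y : V => `|y ord0 j|)}.
    by apply: continuous_comp; [exact: coord_continuous|exact: norm_continuous].
  exact: (cvgr_gt _ cj).
by apply: filterS => y yj; rewrite (sg y j).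
Qed.

Lemma updE (x : V) i s h : upd x i (h + s) = h *: delta_mx ord0 i + upd x i s.
Proof.
apply/rowP => j; rewrite !mxE eqxx/=.
by case: (j == i); rewrite ?mulr1// mulr0 add0r.
Qed.

Lemma is_derive_upd g (x : V) i s :
  derivable g (upd x i s) (delta_mx ord0 i) ->
  is_derive s (1 : R) (fun r => g (upd x i r)) (partial i g (upd x i s)).
Proof.
move=> dg; have E : (fun h : R => h^-1 *: (((fun r => g (upd x i r)) \o shift s) (h *: 1) -
     g (upd x i s))) =
  (fun h => h^-1 *: ((g \o shift (upd x i s)) (h *: delta_mx ord0 i) - g (upd x i s))).
  apply/funext => h /=; congr (_ *: (g _ - _)).
  by rewrite -updE [h *: 1]mulr1.
by split; rewrite /derivable /partial /derive E.
Qed.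

Lemma dot_upd (x t : V) i s : dot (upd x i s) t = s * t ord0 i + dot (upd x i 0) t.
Proof.
rewrite -{1}(addr0 s) updE dotDl dotZl; congr (_ * _ + _).
rewrite /dot (bigD1 i)//= mxE !eqxx/= mul1r big1 ?addr0// => j ji.
by rewrite mxE (negbTE ji) mul0r.
Qed.

Lemma continuous_upd (x : V) i : continuous (fun s => upd x i s).
Proof.
have -> : (fun s => upd x i s) = (fun s => s *: delta_mx ord0 i + upd x i 0).
  by apply/funext => s; rewrite -updE addr0.
by move=> s; apply: cvgD; [exact: scalel_continuous|exact: cvg_cst].
Qed.

Lemma continuous_dot (t : V) : continuous (fun x : V => dot x t).
Proof.
rewrite /dot; elim: (index_enum _) => [|i r IH].
  by under eq_fun do rewrite big_nil; exact: cst_continuous.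
under eq_fun do rewrite big_cons; apply: continuous_addf => //.
by apply: continuous_mulf; [exact: coord_continuous|exact: cst_continuous].
Qed.

Section by_parts.
Variables (M : R) (g : V -> R) (i : 'I_n) (t : V) (u u' : R -> R).
Hypotheses (M0 : 0 <= M) (sg : smooth g) (suppg : supp_in M g).
Hypothesis du : forall s : R, is_derive s (1 : R) u (u' s).
Hypotheses (cu : continuous u) (cu' : continuous u').

Let cg : continuous g. Proof. exact: (sg [::]).1. Qed.
Let cpg : continuous (partial i g). Proof. exact: (sg [:: i]).1. Qed.
Let spg : supp_in M (partial i g). Proof. exact: supp_in_partial. Qed.

Lemma integrable_supp_in_mul_dot (h : V -> R) (v : R -> R) :
  continuous h -> supp_in M h -> continuous v ->
  mu.-integrable setT (EFin \o (fun x => h x * v (dot x t))).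
Proof.
move=> ch sh cv; apply: (@integrable_supp_in M) => //.
- apply: continuous_mulf => //.
  by apply: continuous_compf => //; exact: continuous_dot.
- by move=> x j xj; rewrite (sh x j)// mul0r.
Qed.

(** On each line parallel to the i-th axis, the difference of the two sides is
    the integral of the derivative of g(x) * u(x.t), which has bounded
    support. *)
Lemma integral_by_parts :
  \int[mu]_x (partial i g x * u (dot x t)) =
  - (t ord0 i * \int[mu]_x (g x * u' (dot x t))).
Proof.
have i1 := integrable_supp_in_mul_dot cpg spg cu.
have i2 := integrable_supp_in_mul_dot cg suppg cu'.
have i3 : mu.-integrable setT
    (EFin \o (fun x => t ord0 i * (g x * u' (dot x t)))).
  exact: (integrableZl measurableT (t ord0 i) i2).
apply/eqP; rewrite -addr_eq0 -RintegralZl// -RintegralD//; apply/eqP.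
rewrite /Rintegral; suff -> : (\int[mu]_x (partial i g x * u (dot x t) +
   t ord0 i * (g x * u' (dot x t)))%:E = 0)%E by [].
apply: (integral_slice_eq0 (i := i)).
  exact: (integrableD measurableT i1 i3).
move=> x; pose c := dot (upd x i 0) t.
have ML : 0 < M + 1 by rewrite ltr_wpDl.
apply: (integral_derivative_eq0 (F := fun s => g (upd x i s) * u (dot (upd x i s) t)) ML).
- move=> s; have dg := is_derive_upd ((sg [::]).2 i (upd x i s)).
  have dl := is_deriveD (is_deriveZ (t ord0 i) (is_derive_id s (1 : R)))
    (is_derive_cst c s (1 : R)).
  have -> : (fun r => g (upd x i r) * u (dot (upd x i r) t)) =
      (fun r => g (upd x i r)) * (u \o ((t ord0 i \*: id) + cst c)).
    apply/funext => r; rewrite [RHS]/=; congr (_ * u _).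
    by rewrite dot_upd mulrC.
  apply: (is_derive_eq (is_deriveM dg (is_derive1_comp (du _) dl))).
  have Ed : ((t ord0 i \*: id) + cst c) s = dot (upd x i s) t.
    by rewrite dot_upd/= mulrC.
  have E (a b : R) : a *: (b : R^o) = a * b by [].
  rewrite addr0 /= !Ed !E mulr1.
  move: (g _) (u _) (u' _) (partial _ _ _) (t _ _) => a b a' b' r.
  by ring.
- have cup := @continuous_upd x i.
  have cdu : continuous (fun s => dot (upd x i s) t).
    exact: (continuous_compf cup (@continuous_dot t)).
  apply: continuous_addf.
  + apply: continuous_mulf; first exact: (continuous_compf cup cpg).
    exact: (continuous_compf cdu cu).
  + apply: continuous_mulf; first exact: cst_continuous.
    apply: continuous_mulf; first exact: (continuous_compf cup cg).
    exact: (continuous_compf cdu cu').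
- move=> s Ls; rewrite (suppg (x := upd x i s) (i := i)) ?mul0r// mxE eqxx.
  by rewrite (lt_le_trans _ Ls)// ltrDl.
- move=> s Ls; have Ms : M < `|upd x i s ord0 i|.
    by rewrite mxE eqxx (lt_le_trans _ Ls)// ltrDl.
  by rewrite (suppg Ms) (spg Ms) !mul0r mulr0 addr0.
Qed.

End by_parts.

(** For real g, the Fourier transform of g is a constant times
    cosT g - i sinT g. *)
Definition cosT g (t : V) : R := \int[mu]_x (g x * cos (dot x t)).
Definition sinT g (t : V) : R := \int[mu]_x (g x * sin (dot x t)).
Definition amp g (t : V) : R := `|cosT g t| + `|sinT g t|.

(** Differentiation multiplies the Fourier transform by i t_i; the quarter turn
    exchanges the cosine and the sine parts. *)
Lemma amp_partial M g i t : 0 <= M -> smooth g -> supp_in M g ->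
  amp (partial i g) t = `|t ord0 i| * amp g t.
Proof.
move=> M0 sg suppg.
have dNs (s : R) : is_derive s (1 : R) (@cos R) (- sin s) := is_derive_cos s.
have ds (s : R) : is_derive s (1 : R) (@sin R) (cos s) := is_derive_sin s.
have cNs : continuous (fun s : R => - sin s).
  by move=> s; apply: continuousN; exact: continuous_sin.
have c1 : cosT (partial i g) t = t ord0 i * sinT g t.
  rewrite /cosT (integral_by_parts i t M0 sg suppg dNs (@continuous_cos R) cNs).
  rewrite -mulrN; congr *%R; rewrite -mulN1r -RintegralZl//; last first.
    exact: (integrable_supp_in_mul_dot t M0 (sg [::]).1 suppg cNs).
  by apply: eq_Rintegral => x _; rewrite mulN1r mulrN opprK.
have s1 : sinT (partial i g) t = - (t ord0 i * cosT g t).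
  exact: (integral_by_parts i t M0 sg suppg ds (@continuous_sin R) (@continuous_cos R)).
by rewrite /amp c1 s1 normrN !normrM -mulrDr addrC.
Qed.

Lemma smooth_iter_partial s g : smooth g -> smooth (iter_partial s g).
Proof. by move=> sg r; have := sg (r ++ s); rewrite /iter_partial foldr_cat. Qed.

Lemma supp_in_iter_partial M s g : supp_in M g -> supp_in M (iter_partial s g).
Proof. by move=> sg; elim: s => //= i s; exact: supp_in_partial. Qed.

Lemma amp_iter_partial M s g t : 0 <= M -> smooth g -> supp_in M g ->
  amp (iter_partial s g) t = (\prod_(j <- s) `|t ord0 j|) * amp g t.
Proof.
move=> M0 sg suppg; elim: s => [|i s IH]; first by rewrite big_nil mul1r.
rewrite /= (amp_partial (M := M))// ?IH ?big_cons ?mulrA//.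
- exact: smooth_iter_partial.
- exact: supp_in_iter_partial.
Qed.

Lemma amp_bounded M g : 0 <= M -> continuous g -> supp_in M g ->
  exists2 C, 0 <= C & forall t, amp g t <= C.
Proof.
move=> M0 cg sg; have ig := integrable_supp_in M0 cg sg.
pose I := \int[mu]_x `|g x|.
have I0 : 0 <= I by apply: Rintegral_ge0.
have b (v : R -> R) t : continuous v -> (forall s, `|v s| <= 1) ->
    `|\int[mu]_x (g x * v (dot x t))| <= I.
  move=> cv v1; have iv := integrable_supp_in_mul_dot t M0 cg sg cv.
  rewrite (le_trans (le_normr_Rintegral _ _))//.
  apply: le_Rintegral => //.
  - exact: (integrable_norm iv).
  - exact: (integrable_norm ig).
  - by move=> x _; rewrite normrM ler_piMr.
exists (I + I); first by rewrite addr_ge0.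
move=> t; rewrite lerD//.
- by apply: b; [exact: continuous_cos|exact: cos_max].
- by apply: b; [exact: continuous_sin|exact: sin_max].
Qed.

(** Two integrations by parts in each variable of a set B bound the product of
    the t_i^2 over B times the amplitude; the sum over all B of these products
    is the product of the 1 + t_i^2, that is the inverse of the weight. *)
Lemma amp_decay M g : 0 <= M -> smooth g -> supp_in M g ->
  exists2 C, 0 <= C & forall t, amp g t <= C * weight t.
Proof.
move=> M0 sg suppg.
pose s (B : {set 'I_n}) := enum B ++ enum B.
have bB (B : {set 'I_n}) : exists C, 0 <= C /\ forall t, amp (iter_partial (s B) g) t <= C.
  have [C C0 Ct] := amp_bounded M0 (sg (s B)).1 (supp_in_iter_partial (s B) suppg).
  by exists C.
have [C CP] := choice bB.
exists (\sum_(B : {set 'I_n}) C B); first by apply: sumr_ge0 => B _; exact: (CP B).1.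
move=> t; rewrite /weight prodfV ler_pdivlMr; last first.
  by apply: prodr_gt0 => i _; exact: one_add_sqr_gt0.
under eq_bigr do rewrite addrC.
rewrite bigA_distr mulr_sumr; apply: ler_sum => B _.
rewrite (le_trans _ ((CP B).2 t))// (amp_iter_partial _ _ M0)// mulrC.
rewrite ler_wpM2r ?addr_ge0// big_cat/= !big_enum/= -big_split/=.
rewrite [leRHS]big_mkcond/=; apply: ler_prod => i _.
case: ifP => _; last by rewrite ler01 lexx.
by rewrite sqr_ge0/= -normrM -expr2 ger0_norm ?sqr_ge0.
Qed.

End bounded_support.

(** * The Fourier transform and duality *)

Section fubini_kernel.
Context {R : realType} {n : nat}.
Local Notation V := 'rV[R]_n.
Local Notation mu := (@lebesgue_rV R n).

Lemma measurable_dot2 : measurable_fun setT (fun z : V * V => dot z.1 z.2).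
Proof.
apply: measurable_sum => i; apply: measurable_funM.
- exact: (measurableT_comp (measurable_coord_rV i) measurable_fst).
- exact: (measurableT_comp (measurable_coord_rV i) measurable_snd).
Qed.

Variables (u v : V -> R) (b : R -> R).
Hypotheses (iu : mu.-integrable setT (EFin \o u))
           (iv : mu.-integrable setT (EFin \o v)).
Hypotheses (cb : continuous b) (b1 : forall s, `|b s| <= 1).

Let K (z : V * V) : \bar R := (u z.1 * v z.2 * b (dot z.1 z.2))%:E.

Let meas_u : measurable_fun setT u.
Proof. by have /measurable_EFinP := measurable_int _ iu. Qed.

Let meas_v : measurable_fun setT v.
Proof. by have /measurable_EFinP := measurable_int _ iv. Qed.

Lemma integrable_kernel : (mu \x mu)%E.-integrable setT K.
Proof.
have mK : measurable_fun setT K.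
  apply: measurable_funEFin; apply: measurable_funM.
    apply: measurable_funM.
    - exact: (measurableT_comp meas_u measurable_fst).
    - exact: (measurableT_comp meas_v measurable_snd).
  apply: (measurableT_comp _ measurable_dot2).
  exact: continuous_measurable_fun.
apply/integrable12ltyP => //.
have Iv : (\int[mu]_y `|(v y)%:E| < +oo)%E by have /integrableP[] := iv.
have Iu : (\int[mu]_y `|(u y)%:E| < +oo)%E by have /integrableP[] := iu.
have mau : measurable_fun setT (fun y => `|(u y)%:E|)%E.
  by apply: measurableT_comp => //; exact: measurable_funEFin.
have mav : measurable_fun setT (fun y => `|(v y)%:E|)%E.
  by apply: measurableT_comp => //; exact: measurable_funEFin.
have le1 x : (\int[mu]_y `|K (x, y)| <= `|(u x)%:E| * \int[mu]_y `|(v y)%:E|)%E.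
  rewrite -ge0_integralZl//; apply: ge0_le_integral => //.
  - apply: measurableT_comp => //.
    by apply: (measurableT_comp mK); exact: measurable_pair1.
  - by apply: emeasurable_funM.
  - move=> y _ /=; rewrite -EFinM lee_fin !normrM ler_piMr// mulr_ge0//.
apply: (@le_lt_trans _ _ (\int[mu]_x (`|(u x)%:E| * \int[mu]_y `|(v y)%:E|))%E).
  apply: ge0_le_integral => //.
  - by move=> x _; apply: integral_ge0.
  - apply: (measurable_fun_fubini_tonelli_F (abse \o K)).
      exact: measurableT_comp.
    by move=> x; exact: abse_ge0.
  - by apply: emeasurable_funM.
rewrite ge0_integralZr//; last exact: integral_ge0.
have v0 : (0 <= \int[mu]_y `|(v y)%:E|)%E by exact: integral_ge0.
have u0 : (0 <= \int[mu]_y `|(u y)%:E|)%E by exact: integral_ge0.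
by rewrite lte_mul_pinfty// ge0_fin_numE.
Qed.

(** The cosine and sine transforms at once: b is cos or sin. *)
Definition trigT (h : V -> R) (t : V) : R := \int[mu]_x (h x * b (dot x t)).

Let kernel_inner1 x : (\int[mu]_y K (x, y) = (u x * trigT v x)%:E)%E.
Proof.
rewrite /trigT -RintegralZl//; last exact: integrable_mul_dot.
rewrite -EFin_Rintegral; last first.
  exact: (integrableZl measurableT (u x) (integrable_mul_dot x iv cb b1)).
by apply: eq_integral => y _; rewrite /K/= dotC mulrA.
Qed.

Let kernel_inner2 y : (\int[mu]_x K (x, y) = (v y * trigT u y)%:E)%E.
Proof.
rewrite /trigT -RintegralZl//; last exact: integrable_mul_dot.
rewrite -EFin_Rintegral; last first.
  exact: (integrableZl measurableT (v y) (integrable_mul_dot y iu cb b1)).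
by apply: eq_integral => x _; rewrite /K/= mulrA [v y * _]mulrC.
Qed.

Lemma integrable_mul_trigT :
  mu.-integrable setT (EFin \o (fun x => u x * trigT v x)).
Proof.
have := integrable_fubini_F integrable_kernel.
by rewrite /fubini_F; under eq_fun do rewrite kernel_inner1.
Qed.

(** Fubini's theorem for u(x) v(y) b(x.y). *)
Lemma trigT_adjoint :
  \int[mu]_x (u x * trigT v x) = \int[mu]_y (v y * trigT u y).
Proof.
have E1 : (\int[mu]_x \int[mu]_y K (x, y) =
    \int[mu]_x (u x * trigT v x)%:E)%E.
  by apply: eq_integral => x _; exact: kernel_inner1.
have E2 : (\int[mu]_y \int[mu]_x K (x, y) =
    \int[mu]_y (v y * trigT u y)%:E)%E.
  by apply: eq_integral => y _; exact: kernel_inner2.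
by rewrite /Rintegral -E1 -E2 (Fubini integrable_kernel).
Qed.

End fubini_kernel.

Section trigT_measurable.
Context {R : realType} {n : nat}.
Local Notation V := 'rV[R]_n.
Local Notation mu := (@lebesgue_rV R n).
Variables (v : V -> R) (b : R -> R).
Hypothesis iv : mu.-integrable setT (EFin \o v).
Hypotheses (cb : continuous b) (b1 : forall s, `|b s| <= 1).

(** The product with the weight is an inner integral of Fubini's theorem, hence
    measurable; the weight has no zero. *)
Lemma measurable_trigT : measurable_fun setT (trigT b v).
Proof.
have /measurable_int/measurable_EFinP h :=
  integrable_mul_trigT (@integrable_weight R n) iv cb b1.
have -> : trigT b v = (fun t => \prod_(i < n) (1 + t ord0 i ^+ 2) *
    (weight t * trigT b v t)).
  apply/funext => t; rewrite mulrA [_ * weight t](_ : _ = 1) ?mul1r//.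
  rewrite /weight prodfV divff// gt_eqF//.
  by apply: prodr_gt0 => i _; exact: one_add_sqr_gt0.
apply: measurable_funM => //.
apply: (@measurable_prod_rV R n (fun s => 1 + s ^+ 2)).
by apply: measurable_funD => //; exact: measurable_funX.
Qed.

End trigT_measurable.

Section test_functions.
Context {R : realType} {n : nat}.
Local Open Scope complex_scope.
Local Notation V := 'rV[R]_n.
Local Notation mu := (@lebesgue_rV R n).
Implicit Types phi F : V -> R[i].

Lemma coord_le_norm (x : V) i : `|x ord0 i| <= `|x|.
Proof.
rewrite [leRHS]mx_normrE; exact: (le_bigmax _ (fun ij => `|x ij.1 ij.2|) (ord0, i)).
Qed.

(** A compact support is bounded. *)
Lemma test_fun_supp_in (U : set V) phi : test_fun U phi ->
  exists M, [/\ 0 <= M, supp_in M (fun x => complex.Re (phi x)) &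
    supp_in M (fun x => complex.Im (phi x))].
Proof.
move=> [_ cphi _]; have [M [Mr MP]] := compact_bounded cphi.
pose M1 := Num.max 0 (M + 1).
have H (x : V) i : M1 < `|x ord0 i| -> phi x = 0.
  move=> xi; apply/eqP; apply: contrapT => /negP px.
  have : `|x| <= M1.
    have h : `|x| <= M + 1.
      apply: (MP (M + 1)); first by rewrite ltrDl.
      by apply: subset_closure.
    by rewrite le_max h orbT.
  by rewrite leNgt (lt_le_trans xi)// coord_le_norm.
exists M1; split; first by rewrite le_max lexx.
- by move=> x i /H ->.
- by move=> x i /H ->.
Qed.

Let c0 : R := (2 * pi) `^ (- (n%:R / 2)).

Section fourier_of_test_function.
Variables (U : set V) (phi : V -> R[i]).
Hypothesis tphi : test_fun U phi.
Let a x := complex.Re (phi x).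
Let b x := complex.Im (phi x).

Lemma integrable_test_fun : mu.-integrable setT (EFin \o a) /\
  mu.-integrable setT (EFin \o b).
Proof.
have [M [M0 sa sb]] := test_fun_supp_in tphi; have [[ca cb] _ _] := tphi.
split; apply: (integrable_supp_in M0) => //.
- exact: (ca [::]).1.
- exact: (cb [::]).1.
Qed.

Let ia := integrable_test_fun.1.
Let ib := integrable_test_fun.2.

Lemma fourier_test_fun t : fourier phi t =
  (c0 * (cosT a t + sinT b t)) +i* (c0 * (cosT b t - sinT a t)).
Proof.
have ca := integrable_mul_dot t ia (@continuous_cos R) (@cos_max R).
have cb := integrable_mul_dot t ib (@continuous_cos R) (@cos_max R).
have sa := integrable_mul_dot t ia (@continuous_sin R) (@sin_max R).
have sb := integrable_mul_dot t ib (@continuous_sin R) (@sin_max R).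
apply/eqP; rewrite eq_complex /fourier cReZ cImZ /= -/c0.
apply/andP; split; apply/eqP; congr *%R.
- rewrite -RintegralD//; apply: eq_Rintegral => x _.
  by rewrite cReM/= cosN sinN mulrN opprK.
- rewrite -RintegralB//; apply: eq_Rintegral => x _.
  by rewrite cImM/= cosN sinN mulrN addrC.
Qed.

Lemma fourier_test_fun_decay : exists2 C, 0 <= C & forall t,
  `|complex.Re (fourier phi t)| <= C * weight t /\
  `|complex.Im (fourier phi t)| <= C * weight t.
Proof.
have [M [M0 sa sb]] := test_fun_supp_in tphi; have [[ca cb] _ _] := tphi.
have [Ca Ca0 CaP] := amp_decay M0 ca sa; have [Cb Cb0 CbP] := amp_decay M0 cb sb.
have c00 : 0 <= c0 by exact: powR_ge0.
exists (c0 * (Ca + Cb)); first by rewrite mulr_ge0// addr_ge0.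
move=> t; rewrite fourier_test_fun/= !normrM (ger0_norm c00) -!mulrA mulrDl.
have := CaP t; have := CbP t; rewrite /amp -/a -/b => hb ha.
have := normr_ge0 (cosT a t); have := normr_ge0 (cosT b t).
have := normr_ge0 (sinT a t); have := normr_ge0 (sinT b t) => ? ? ? ?.
split; apply: ler_wpM2l => //.
- have := ler_normD (cosT a t) (sinT b t); lra.
- have := ler_normB (cosT b t) (sinT a t); lra.
Qed.

Lemma cmeasurable_fourier_test_fun : cmeasurable (fourier phi).
Proof.
have mca := measurable_trigT ia (@continuous_cos R) (@cos_max R).
have mcb := measurable_trigT ib (@continuous_cos R) (@cos_max R).
have msa := measurable_trigT ia (@continuous_sin R) (@sin_max R).
have msb := measurable_trigT ib (@continuous_sin R) (@sin_max R).
split; under eq_fun do rewrite fourier_test_fun/=; apply: measurable_funM => //.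
- exact: measurable_funD.
- exact: measurable_funB.
Qed.

(** The hypothesis says that the Fourier transform of F, whose real and
    imaginary parts are the two combinations, vanishes where phi does not;
    Fubini's theorem moves the Fourier transform from phi to F. *)
Lemma distribution_of_fourier_eq0 F :
  mu.-integrable setT (EFin \o (fun x => complex.Re (F x))) ->
  mu.-integrable setT (EFin \o (fun x => complex.Im (F x))) ->
  (forall t, phi t != 0 ->
     cosT (fun x => complex.Re (F x)) t + sinT (fun x => complex.Im (F x)) t = 0 /\
     cosT (fun x => complex.Im (F x)) t - sinT (fun x => complex.Re (F x)) t = 0) ->
  distribution_of F (fourier phi) = 0.
Proof.
set p := (fun x => complex.Re (F x)); set q := (fun x => complex.Im (F x)).
move=> ip iq F0.
have cc := @continuous_cos R; have cs := @continuous_sin R.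
have c1 := @cos_max R; have s1 := @sin_max R.
have Ea t : a t * (cosT p t + sinT q t) = 0 /\ a t * (cosT q t - sinT p t) = 0.
  have [pt|/F0[-> ->]] := eqVneq (phi t) 0; last by rewrite !mulr0.
  by rewrite /a pt/= !mul0r.
have Eb t : b t * (cosT p t + sinT q t) = 0 /\ b t * (cosT q t - sinT p t) = 0.
  have [pt|/F0[-> ->]] := eqVneq (phi t) 0; last by rewrite !mulr0.
  by rewrite /b pt/= !mul0r.
have ZD (h k : V -> R) : mu.-integrable setT (EFin \o h) ->
    mu.-integrable setT (EFin \o k) -> mu.-integrable setT (EFin \o (fun x => h x + k x)).
  by move=> ih ik; exact: (integrableD measurableT ih ik).
have ZB (h k : V -> R) : mu.-integrable setT (EFin \o h) ->
    mu.-integrable setT (EFin \o k) -> mu.-integrable setT (EFin \o (fun x => h x - k x)).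
  by move=> ih ik; exact: (integrableB measurableT ih ik).
have Ic h k ih ik := @integrable_mul_trigT R n h k (@cos R) ih ik cc c1.
have Is h k ih ik := @integrable_mul_trigT R n h k (@sin R) ih ik cs s1.
have Ac h k ih ik := @trigT_adjoint R n h k (@cos R) ih ik cc c1.
have As h k ih ik := @trigT_adjoint R n h k (@sin R) ih ik cs s1.
have Z (h : V -> R) : mu.-integrable setT (EFin \o h) ->
    (forall t, h t * (cosT p t + sinT q t) = 0 /\
               h t * (cosT q t - sinT p t) = 0) ->
    \int[mu]_t (h t * cosT p t) + \int[mu]_t (h t * sinT q t) = 0 /\
    \int[mu]_t (h t * cosT q t) - \int[mu]_t (h t * sinT p t) = 0.
  move=> ih Eh; have j1 := Ic h p ih ip; have j2 := Is h q ih iq.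
  have j3 := Ic h q ih iq; have j4 := Is h p ih ip.
  rewrite -RintegralD// -RintegralB//; split.
  - under eq_Rintegral => t _ do rewrite -mulrDr (Eh t).1.
    by rewrite /Rintegral integral0.
  - under eq_Rintegral => t _ do rewrite -mulrBr (Eh t).2.
    by rewrite /Rintegral integral0.
have [Za1 Za2] := Z a ia Ea; have [Zb1 Zb2] := Z b ib Eb.
have pca := Ic p a ip ia; have psb := Is p b ip ib.
have qcb := Ic q b iq ib; have qsa := Is q a iq ia.
have pcb := Ic p b ip ib; have psa := Is p a ip ia.
have qca := Ic q a iq ia; have qsb := Is q b iq ib.
rewrite /distribution_of /cintegral; apply/eqP; rewrite eq_complex/=.
apply/andP; split; apply/eqP.
- transitivity (\int[mu]_x (c0 * ((p x * cosT a x + p x * sinT b x) -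
     (q x * cosT b x - q x * sinT a x)))).
    apply: eq_Rintegral => x _; rewrite cReM fourier_test_fun/= -/(p x) -/(q x).
    by ring.
  have i1 := ZD _ _ pca psb; have i2 := ZB _ _ qcb qsa.
  rewrite RintegralZl//; last exact: (ZB _ _ i1 i2).
  rewrite RintegralB// RintegralD// RintegralB//.
  rewrite (Ac p a)// (As p b)// (Ac q b)// (As q a)//.
  move: Za1 Zb2.
  set A1 := Rintegral _ _ _; set A2 := Rintegral _ _ _ => h1.
  set A3 := Rintegral _ _ _; set A4 := Rintegral _ _ _ => h2.
  rewrite (_ : _ - _ = (A1 + A2) - (A3 - A4)); last by ring.
  by rewrite h1 h2 subrr mulr0.
- transitivity (\int[mu]_x (c0 * ((p x * cosT b x - p x * sinT a x) +
     (q x * cosT a x + q x * sinT b x)))).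
    apply: eq_Rintegral => x _; rewrite cImM fourier_test_fun/= -/(p x) -/(q x).
    by ring.
  have i1 := ZB _ _ pcb psa; have i2 := ZD _ _ qca qsb.
  rewrite RintegralZl//; last exact: (ZD _ _ i1 i2).
  rewrite RintegralD// RintegralB// RintegralD//.
  rewrite (Ac p b)// (As p a)// (Ac q a)// (As q b)//.
  move: Zb1 Za2.
  set A1 := Rintegral _ _ _; set A2 := Rintegral _ _ _ => h1.
  set A3 := Rintegral _ _ _; set A4 := Rintegral _ _ _ => h2.
  rewrite (_ : _ + _ = (A1 + A2) + (A3 - A4)); last by ring.
  by rewrite h1 h2 addr0 mulr0.
Qed.

End fourier_of_test_function.

End test_functions.

(** * The spectrum of the approximations and of the limit *)

Section spectrum.
Context {R : realType} {n : nat}.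
Local Open Scope complex_scope.
Local Notation normc := (@ComplexField.Normc.normc R).
Local Notation V := 'rV[R]_n.
Local Notation mu := (@lebesgue_rV R n).

Lemma integrable_prod_fejer a : 0 < a ->
  mu.-integrable setT (EFin \o prod_fejer a).
Proof.
move=> a0; apply/integrableP; split.
  by apply: measurable_funEFin; exact: measurable_prod_fejer.
under eq_integral => x _ do rewrite /= ger0_norm ?prod_fejer_ge0//.
by rewrite integral_prod_fejer// ltry.
Qed.

Lemma integrable_prod_fejerM a (b : R -> R) (v : V) : 0 < a ->
  continuous b -> (forall s, `|b s| <= 1) ->
  mu.-integrable setT (EFin \o (fun x => prod_fejer a x * b (dot v x))).
Proof.
move=> a0 cb b1; have := integrable_mul_dot v (integrable_prod_fejer a0) cb b1.
by congr (is_true (integrable _ _ (EFin \o _))); apply/funext => x; rewrite dotC.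
Qed.

Lemma prod_fejer_upd a (x : V) i s :
  prod_fejer a (upd x i s) =
  fejer (a * s) * \prod_(j | j != i) fejer (a * x ord0 j).
Proof.
rewrite /prod_fejer (bigD1 i)//= mxE eqxx; congr *%R.
by apply: eq_bigr => j ji; rewrite mxE (negbTE ji).
Qed.

(** A frequency v with a coordinate of modulus at least a is outside of the
    spectrum of the kernel: on each line parallel to that axis the integrand is a
    combination of the integrands of [integral_fejer_cos] and
    [integral_fejer_sin]. *)
Lemma integral_prod_fejer_trig (a : R) (v : V) i : 0 < a -> a <= `|v ord0 i| ->
  (\int[mu]_x (prod_fejer a x * cos (dot v x))%:E = 0)%E /\
  (\int[mu]_x (prod_fejer a x * sin (dot v x))%:E = 0)%E.
Proof.
move=> a0 av; have cc := @continuous_cos R; have cs := @continuous_sin R.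
have c1 := @cos_max R; have s1 := @sin_max R.
have Ic := integral_fejer_cos a0 av; have Is := integral_fejer_sin (v ord0 i) a0.
have mlin : measurable_fun setT (fun s : R => v ord0 i * s) by exact: mulrl_measurable.
have Jc : lebesgue_measure.-integrable setT
    (fun s => (fejer (a * s) * cos (v ord0 i * s))%:E).
  apply: integrable_fejer_scaleM => //.
  by apply: (measurableT_comp _ mlin); exact: continuous_measurable_fun.
have Js : lebesgue_measure.-integrable setT
    (fun s => (fejer (a * s) * sin (v ord0 i * s))%:E).
  apply: integrable_fejer_scaleM => //.
  by apply: (measurableT_comp _ mlin); exact: continuous_measurable_fun.
have slice (k1 k2 : R) : (\int[lebesgue_measure]_s
    (k1 * (fejer (a * s) * cos (v ord0 i * s)) +
     k2 * (fejer (a * s) * sin (v ord0 i * s)))%:E = 0)%E.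
  under eq_integral do rewrite EFinD (EFinM k1) (EFinM k2).
  rewrite integralD//; [|exact: integrableZl|exact: integrableZl].
  by rewrite !integralZl// Ic Is !mule0 adde0.
have dv x s : dot v (upd x i s) = v ord0 i * s + dot v (upd x i 0).
  by rewrite dotC dot_upd mulrC dotC.
split; apply: (integral_slice_eq0 (i := i)).
- exact: (integrable_prod_fejerM v a0 cc c1).
- move=> x; set k := \prod_(j | j != i) fejer (a * x ord0 j).
  set c := dot v (upd x i 0).
  rewrite -[RHS](slice (k * cos c) (- (k * sin c))); apply: eq_integral => s _.
  by rewrite prod_fejer_upd dv cosD -/k -/c; congr EFin; ring.
- exact: (integrable_prod_fejerM v a0 cs s1).
- move=> x; set k := \prod_(j | j != i) fejer (a * x ord0 j).
  set c := dot v (upd x i 0).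
  rewrite -[RHS](slice (k * sin c) (k * cos c)); apply: eq_integral => s _.
  by rewrite prod_fejer_upd dv sinD -/k -/c; congr EFin; ring.
Qed.

Variables (N T : nat).
Hypothesis N0 : (0 < N)%N.

Let Re_approx k (D : seq V) x : complex.Re (approx N T k D x) =
  \sum_(d <- D) T%:R ^- k * (prod_fejer (scale N k) x * cos (dot d x)).
Proof.
rewrite /approx /exp_sum cReZ cRe_sum mulr_sumr; apply: eq_bigr => d _.
by rewrite mulrA.
Qed.

Let Im_approx k (D : seq V) x : complex.Im (approx N T k D x) =
  \sum_(d <- D) T%:R ^- k * (prod_fejer (scale N k) x * sin (dot d x)).
Proof.
rewrite /approx /exp_sum cImZ cIm_sum mulr_sumr; apply: eq_bigr => d _.
by rewrite mulrA.
Qed.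

Let integrable_comb k (D : seq V) (b : R -> R) (t : V) : continuous b ->
  (forall s, `|b s| <= 1) -> mu.-integrable setT (EFin \o (fun x =>
    \sum_(d <- D) T%:R ^- k * (prod_fejer (scale N k) x * b (dot (d - t) x)))).
Proof.
move=> cb b1; have -> : EFin \o (fun x =>
    \sum_(d <- D) T%:R ^- k * (prod_fejer (scale N k) x * b (dot (d - t) x))) =
  (fun x => \sum_(d <- D) (T%:R ^- k * (prod_fejer (scale N k) x * b (dot (d - t) x)))%:E)%E.
  by apply/funext => x /=; rewrite sumEFin.
apply: integrable_sum => // d _.
exact: (integrableZl measurableT _ (integrable_prod_fejerM (d - t) (scale_gt0 N0 k) cb b1)).
Qed.

Let integral_comb_eq0 k (D : seq V) (b : R -> R) (t : V) : continuous b ->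
  (forall s, `|b s| <= 1) ->
  (forall d, d \in D ->
    (\int[mu]_x (prod_fejer (scale N k) x * b (dot (d - t) x))%:E = 0)%E) ->
  \int[mu]_x (\sum_(d <- D)
     T%:R ^- k * (prod_fejer (scale N k) x * b (dot (d - t) x))) = 0.
Proof.
move=> cb b1 D0; elim: D D0 => [|d D IH] D0.
  by under eq_Rintegral do rewrite big_nil; rewrite /Rintegral integral0.
under eq_Rintegral do rewrite big_cons.
have id := integrable_prod_fejerM (d - t) (scale_gt0 N0 k) cb b1.
rewrite RintegralD//; last 2 first.
- exact: (integrableZl measurableT _ id).
- exact: integrable_comb.
rewrite RintegralZl// IH ?addr0; last by move=> d' d'D; apply: D0; rewrite inE d'D orbT.
by rewrite /Rintegral D0 ?mulr0// inE eqxx.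
Qed.

Lemma integrable_approx k (D : seq V) :
  mu.-integrable setT (EFin \o (fun x => complex.Re (approx N T k D x))) /\
  mu.-integrable setT (EFin \o (fun x => complex.Im (approx N T k D x))).
Proof.
split.
- have := integrable_comb k D 0 (@continuous_cos R) (@cos_max R).
  congr (is_true (integrable _ _ (EFin \o _))); apply/funext => x.
  by rewrite Re_approx; apply: eq_bigr => d _; rewrite subr0.
- have := integrable_comb k D 0 (@continuous_sin R) (@sin_max R).
  congr (is_true (integrable _ _ (EFin \o _))); apply/funext => x.
  by rewrite Im_approx; apply: eq_bigr => d _; rewrite subr0.
Qed.

(** The spectrum of approx k D lies in these cubes ([approx_spectrum]); they are
    closed, so that the set where it vanishes is open. *)
Definition cubes (k : nat) (D : seq V) : set V :=
  [set t | exists2 d, d \in D & forall i, `|t ord0 i - d ord0 i| <= scale N k].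

(** Multiplication by exp(-i x.t) moves the frequency d to d - t, which has a
    coordinate of modulus larger than N^-k, outside of the spectrum of the
    kernel. *)
Lemma approx_spectrum k (D : seq V) (t : V) : ~ cubes k D t ->
  cosT (fun x => complex.Re (approx N T k D x)) t +
  sinT (fun x => complex.Im (approx N T k D x)) t = 0 /\
  cosT (fun x => complex.Im (approx N T k D x)) t -
  sinT (fun x => complex.Re (approx N T k D x)) t = 0.
Proof.
move=> tD.
have far d : d \in D -> exists i, scale N k <= `|(d - t) ord0 i|.
  move=> dD; apply: contrapT => /forallNP h; apply: tD; exists d => // i.
  rewrite distrC leNgt; apply/negP => hi; apply: (h i).
  by rewrite !mxE ltW.
have [ir ii] := integrable_approx k D.
have rc := integrable_mul_dot t ir (@continuous_cos R) (@cos_max R).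
have rs := integrable_mul_dot t ir (@continuous_sin R) (@sin_max R).
have ic := integrable_mul_dot t ii (@continuous_cos R) (@cos_max R).
have is' := integrable_mul_dot t ii (@continuous_sin R) (@sin_max R).
rewrite /cosT /sinT -RintegralD// -RintegralB//; split.
- rewrite -[RHS](@integral_comb_eq0 k D (@cos R) t).
  + apply: eq_Rintegral => x _; rewrite Re_approx Im_approx !mulr_suml -big_split/=.
    apply: eq_bigr => d _; rewrite dotBl cosB [dot t x]dotC; ring.
  + exact: continuous_cos.
  + exact: cos_max.
  + by move=> d /far[i di]; have [] := integral_prod_fejer_trig (scale_gt0 N0 k) di.
- rewrite -[RHS](@integral_comb_eq0 k D (@sin R) t).
  + apply: eq_Rintegral => x _; rewrite Re_approx Im_approx !mulr_suml -sumrB.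
    apply: eq_bigr => d _; rewrite dotBl sinB [dot t x]dotC; ring.
  + exact: continuous_sin.
  + exact: sin_max.
  + by move=> d /far[i di]; have [] := integral_prod_fejer_trig (scale_gt0 N0 k) di.
Qed.

Lemma closed_cubes k (D : seq V) : closed (cubes k D).
Proof.
have -> : cubes k D = \bigcup_(d in [set` D])
    [set t : V | forall i, `|t ord0 i - d ord0 i| <= scale N k].
  by apply/seteqP; split => [t [d dD td]|t [d dD td]]; exists d.
apply: closed_bigcup; first exact: finite_seq.
move=> d _.
have -> : [set t : V | forall i, `|t ord0 i - d ord0 i| <= scale N k] =
    \bigcap_(i in [set: 'I_n]) ((fun t : V => `|t ord0 i - d ord0 i|) @^-1`
      [set s | s <= scale N k]).
  by apply/seteqP; split => [t td i _|t td i]; [exact: td|exact: td].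
apply: closed_bigI => i _; apply: closed_comp; last exact: closed_le.
have cd : continuous (fun t : V => t ord0 i + - d ord0 i).
  by apply: continuous_addf; [exact: coord_continuous|exact: cst_continuous].
have cn : continuous (fun s : R => `|s|) by exact: norm_continuous.
have c : continuous (fun t : V => `|t ord0 i + - d ord0 i|).
  by exact: (@continuous_compf R _ _ (fun t : V => t ord0 i + - d ord0 i) _ cd cn).
by move=> t _; exact: c.
Qed.

End spectrum.

Section spectrum_limit.
Context {R : realType} {n : nat}.
Local Open Scope complex_scope.
Local Notation normc := (@ComplexField.Normc.normc R).
Local Notation V := 'rV[R]_n.
Local Notation mu := (@lebesgue_rV R n).

(** Dominated convergence. *)
Lemma cvg_integral_le_weight (g_ : nat -> V -> R) (g : V -> R) (c : R) :
  (forall k, measurable_fun setT (g_ k)) ->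
  (forall k x, `|g_ k x| <= c * weight x) ->
  (forall x, g_ k x @[k --> \oo] --> g x) ->
  \int[mu]_x g_ k x @[k --> \oo] --> \int[mu]_x g x.
Proof.
move=> mg gc gg.
have mg' : measurable_fun setT g.
  by apply: (measurable_fun_cvg (h := g_)) => // x _; exact: gg.
have g'c x : `|g x| <= c * weight x.
  have gn : `|g_ k x| @[k --> \oo] --> `|g x| by apply: cvg_norm; exact: gg.
  by apply: (cvgr_to_le gn); apply: nearW => k; exact: gc.
have ig : mu.-integrable setT (EFin \o g) := le_weight_integrable mg' g'c.
have ig_ k : mu.-integrable setT (EFin \o g_ k) := le_weight_integrable (mg k) (gc k).
have iw : mu.-integrable setT (EFin \o (fun x : V => c * weight x)).
  have w0 (x : V) : 0 <= c * weight x by apply: le_trans (gc 0%N x).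
  apply: (@le_weight_integrable _ _ _ c) => [|x]; last by rewrite ger0_norm.
  by apply: measurable_funM => //; exact: measurable_weight.
have gg' x : (g_ k x)%:E @[k --> \oo] --> (g x)%:E by exact: (cvg_comp _ _ (gg x)).
have dom := @dominated_convergence _ _ _ mu setT measurableT
  (fun k => EFin \o g_ k) (EFin \o g) (fun x => (c * weight x)%:E)
  (fun k => measurable_funEFin (mg k)) (measurable_funEFin mg').
have [||_ _ h] := dom _ iw; first by apply: aeW => x _; exact: gg'.
  by apply: aeW => x k _; rewrite /= lee_fin.
apply: fine_cvg; rewrite -EFin_Rintegral; last exact: ig.
exact: h.
Qed.

Lemma distribution_of_limit_eq0 (F : nat -> V -> R[i]) (f : V -> R[i])
    (U : set V) (phi : V -> R[i]) : test_fun U phi ->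
  (forall k, cmeasurable (F k)) -> (forall k x, normc (F k x) <= 1) ->
  (forall x, complex.Re (F k x) @[k --> \oo] --> complex.Re (f x)) ->
  (forall x, complex.Im (F k x) @[k --> \oo] --> complex.Im (f x)) ->
  (\forall k \near \oo, distribution_of (F k) (fourier phi) = 0) ->
  distribution_of f (fourier phi) = 0.
Proof.
move=> tphi mF F1 FRe FIm F0.
have [C C0 fC] := fourier_test_fun_decay tphi.
have mphi := cmeasurable_fourier_test_fun tphi.
set psi := fourier phi in F0 fC mphi *.
have mFp k : cmeasurable (fun x => F k x * psi x) by exact: cmeasurableM.
have bound k x : `|complex.Re (F k x)| <= 1 /\ `|complex.Im (F k x)| <= 1.
  by split; apply: le_trans (F1 k x); [exact: normr_Re_le|exact: normr_Im_le].
have cRe : \int[mu]_x complex.Re (F k x * psi x) @[k --> \oo] -->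
    \int[mu]_x complex.Re (f x * psi x).
  apply: (@cvg_integral_le_weight _ _ (C + C)) => [k|k x|x].
  - exact: (mFp k).1.
  - rewrite cReM (le_trans (ler_normB _ _))// !normrM mulrDl lerD//.
    + by rewrite (le_trans _ (fC x).1)// ler_piMl// (bound k x).1.
    + by rewrite (le_trans _ (fC x).2)// ler_piMl// (bound k x).2.
  - rewrite cReM; under eq_fun do rewrite cReM.
    by apply: cvgB; apply: cvgM => //; exact: cvg_cst.
have cIm : \int[mu]_x complex.Im (F k x * psi x) @[k --> \oo] -->
    \int[mu]_x complex.Im (f x * psi x).
  apply: (@cvg_integral_le_weight _ _ (C + C)) => [k|k x|x].
  - exact: (mFp k).2.
  - rewrite cImM (le_trans (ler_normD _ _))// !normrM mulrDl lerD//.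
    + by rewrite (le_trans _ (fC x).2)// ler_piMl// (bound k x).1.
    + by rewrite (le_trans _ (fC x).1)// ler_piMl// (bound k x).2.
  - rewrite cImM; under eq_fun do rewrite cImM.
    by apply: cvgD; apply: cvgM => //; exact: cvg_cst.
have lim0 (u : nat -> R) l : u k @[k --> \oo] --> l ->
    (\forall k \near \oo, u k = 0) -> l = 0.
  move=> ul u0; apply: (@cvg_unique _ _ (u k @[k --> \oo])) => //.
  by apply: cvg_near_cst.
rewrite /distribution_of /cintegral.
rewrite (lim0 _ _ cRe) ?(lim0 _ _ cIm)//.
- by near=> k; have /(congr1 (@complex.Im R)) : distribution_of (F k) psi = 0 by near: k.
- by near=> k; have /(congr1 (@complex.Re R)) : distribution_of (F k) psi = 0 by near: k.
Unshelve. all: by end_near. Qed.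

Section limit_set.
Variables (N T : nat).
Hypothesis N1 : (1 < N)%N.
Hypothesis T0 : (0 < T)%N.
Variable D : nat -> seq V.
Hypothesis sD : forall k, size (D k) = (T ^ k)%N.
Hypothesis Dnested : forall k (d' : V), d' \in D k.+1 ->
  exists2 d : V, d \in D k &
    forall i, `|d' ord0 i - d ord0 i| <= scale N k - scale N k.+1.
Hypothesis Dincr : forall k x,
  normc (approx N T k.+1 (D k.+1) x - approx N T k (D k) x) <=
    4 * scale N k * \sum_i `|x ord0 i|.

Definition limit_set : set V := \bigcap_k cubes N k (D k).

(** The children of d stay within N^-k - N^-(k+1) of d, so their cubes lie in
    the cube of d. *)
Lemma cubes_nested k : cubes N k.+1 (D k.+1) `<=` cubes N k (D k).
Proof.
move=> t [d' d'D td']; have [d dD d'd] := Dnested d'D; exists d => // i.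
have h := ler_distD (d' ord0 i) (t ord0 i) (d ord0 i).
by have := td' i; have := d'd i; lra.
Qed.

Lemma cubes_decreasing j k : (j <= k)%N -> cubes N k (D k) `<=` cubes N j (D j).
Proof.
move=> /subnK <-; elim: (k - j)%N => [//|m IH]; rewrite addSn.
exact: (subset_trans (@cubes_nested _) IH).
Qed.

(** A point outside of E is outside of the cubes of some level K. The complement
    of these cubes is open, and the spectra of all the approximations from the
    level K on avoid it. *)
Lemma dist_supp_limit_fun :
  dist_supp (fourier_dist (distribution_of (limit_fun N T D))) `<=` limit_set.
Proof.
move=> t supp_t K _; apply: contrapT => tK; apply: supp_t.
exists (~` cubes N K (D K)) => //; split.
  by rewrite openC; exact: closed_cubes.
move=> phi tphi; rewrite /fourier_dist.
apply: (distribution_of_limit_eq0 tphi (F := fun k => approx N T k (D k))).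
- by move=> k; exact: cmeasurable_approx.
- by move=> k x; exact: normc_approx_le1.
- by move=> x; apply: cvg_Re_approx.
- by move=> x; exact: cvg_Im_approx.
near=> k; have Kk : (K <= k)%N by near: k; exact: nbhs_infty_ge.
have [iRe iIm] := integrable_approx T (ltnW N1) k (D k).
apply: (distribution_of_fourier_eq0 tphi iRe iIm) => s phis.
apply: approx_spectrum; first exact: ltnW.
have [_ _ out] := tphi => /(cubes_decreasing Kk); apply: out.
exact: subset_closure.
Unshelve. all: by end_near. Qed.

End limit_set.

End spectrum_limit.

(** * The packing measure *)

(** At most T^l terms have level l, so the sum is dominated by a geometric
    series. *)
Lemma sum_level_le (R : realType) (I : eqType) (s : seq I) (L : I -> nat)
    (T : nat) (B w : R) : (0 < T)%N -> 0 <= B -> 0 < w -> T%:R * w < 1 ->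
  (forall l, (count (fun i => L i == l) s <= T ^ l)%N) ->
  \sum_(i <- s) B * w ^+ L i <= B * (1 - T%:R * w)^-1.
Proof.
move=> T0 B0 w0 q1 cs; have q0 : 0 < T%:R * w by rewrite mulr_gt0 ?ltr0n.
pose M := (\max_(i <- s) L i).+1.
have LM i : i \in s -> (L i < M)%N by move=> si; rewrite ltnS; exact: leq_bigmax_seq.
rewrite (partition_big (fun i => inord (L i) : 'I_M.+1) xpredT)//=.
apply: (@le_trans _ _ (series (geometric B (T%:R * w)) M.+1)); last first.
  by apply: geometric_le_lim => //; rewrite gtr0_norm.
rewrite /series/= big_mkord; apply: ler_sum => l _.
have LE i : i \in s -> ((inord (L i) : 'I_M.+1) == l) = (L i == l).
  by move=> /LM si; rewrite -val_eqE/= inordK// ltnS ltnW.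
rewrite big_seq_cond; under eq_bigl => i.
  rewrite (_ : _ && _ = (i \in s) && (L i == l)); first over.
  by case: (boolP (i \in s)) => //= /LE.
rewrite -big_seq_cond; under eq_bigr => i /eqP -> do over.
rewrite big_const_seq iter_addr addr0 exprMn -natrX mulrCA -[leLHS]mulr_natl.
apply: ler_wpM2r; last by rewrite ler_nat.
by rewrite mulr_ge0 ?exprn_ge0 ?(ltW w0).
Qed.

Section packing_bound.
Context {R : realType} {n : nat}.
Local Notation V := 'rV[R]_n.

Lemma enorm_le (z : V) (b : R) : 0 <= b -> (forall i, `|z ord0 i| <= b) ->
  enorm z <= n%:R * b.
Proof.
move=> b0 zb; have nb0 : 0 <= n%:R * b by rewrite mulr_ge0.
rewrite /enorm -(ger0_norm nb0) -sqrtr_sqr ler_wsqrtr//.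
rewrite exprMn; have zb2 i : z ord0 i * z ord0 i <= b ^+ 2.
  by rewrite -expr2 -real_normK ?num_real// lerXn2r ?nnegrE.
apply: (@le_trans _ _ (\sum_(i < n) b ^+ 2)); first exact: ler_sum.
rewrite sumr_const card_ord -[leLHS]mulr_natl ler_wpM2r ?sqr_ge0//.
by rewrite -natrX ler_nat; case: (n) => // m; rewrite expnS leq_pmulr.
Qed.

Variables (N T : nat) (alpha : R) (D : nat -> seq V) (E : set V).
Hypothesis N1 : (1 < N)%N.
Hypothesis T0 : (0 < T)%N.
Hypothesis alpha0 : 0 < alpha.
Hypothesis T_small : T%:R * N%:R `^ (- alpha) < 1.
Hypothesis sD : forall k, size (D k) = (T ^ k)%N.
Hypothesis ED : forall k, E `<=` cubes N k (D k).

Lemma enorm0 : enorm (0 : V) = 0.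
Proof. by rewrite /enorm /dot big1 ?sqrtr0// => i _; rewrite mxE mul0r. Qed.

(* Two points of the same cube of level k are at a Euclidean distance smaller
   than radius k. *)
Let radius k : R := (2 * n%:R + 1) * scale N k.

Let radius_gt0 k : 0 < radius k.
Proof. by rewrite mulr_gt0 ?scale_gt0 ?(ltnW N1)// ltr_wpDl ?mulr_ge0. Qed.

Let exists_radius (r : R) : 0 < r -> exists k, radius k <= r.
Proof.
move=> r0.
have : radius k @[k --> \oo] --> (2 * n%:R + 1) * (0 : R).
  apply: cvgM; first exact: cvg_cst.
  have -> : scale N = (fun k => (N%:R^-1 : R) ^+ k).
    by apply/funext => k; rewrite /scale exprVn.
  by apply: cvg_expr; rewrite normfV normr_nat invf_lt1 ?ltr1n// ltr0n ltnW.
rewrite mulr0 => /cvgr0_norm_le /(_ r r0)[k _ /(_ k (leqnn k))]; exists k.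
by apply: le_trans (ler_norm _) _.
Qed.

(** The first level whose radius is at most r. The radius of level 0 is at
    least 1, which covers the case where this first level is 0. *)
Lemma exists_level (r : R) : 0 < r <= 2^-1 -> exists k,
  radius k <= r <= N%:R * radius k.
Proof.
move=> /andP[r0 r1]; have ex := exists_radius r0.
have [k rk kmin] := ex_minnP ex; exists k; rewrite rk/=.
have N0 : 0 < N%:R :> R by rewrite ltr0n ltnW.
case: k rk kmin => [|k] rk kmin.
  have : 1 <= N%:R * radius 0.
    rewrite /radius /scale expr0 invr1 mulr1.
    by rewrite -[leLHS]mulr1 ler_pM// ?ler1n ?(ltnW N1)// lerDr mulr_ge0.
  lra.
have -> : N%:R * radius k.+1 = radius k.
  by rewrite /radius mulrCA /scale exprS invfM mulVKf ?gt_eqF.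
by rewrite leNgt; apply/negP => /ltW /kmin; rewrite ltnn.
Qed.

(** Otherwise the centre of the j-th ball would belong to the i-th ball. *)
Lemma packing_level_injective (Y : set nat) (x : nat -> V) (r : nat -> R) k i j
    (d : V) : trivIset Y (fun k => eball (x k) (r k)) -> Y i -> Y j ->
  radius k <= r i -> 0 < r j ->
  (forall c, `|x i ord0 c - d ord0 c| <= scale N k) ->
  (forall c, `|x j ord0 c - d ord0 c| <= scale N k) -> i = j.
Proof.
move=> tY Yi Yj ri rj xid xjd; apply: tY => //; exists (x j); split.
  have s0 : 0 < scale N k :> R by rewrite scale_gt0// ltnW.
  rewrite /eball/= (lt_le_trans _ ri)//.
  apply: (@le_lt_trans _ _ (n%:R * (2 * scale N k))).
    apply: enorm_le; first by rewrite mulr_ge0// ltW.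
    move=> c; rewrite !mxE; have := ler_distD (d ord0 c) (x j ord0 c) (x i ord0 c).
    have := xjd c; have := xid c; rewrite (distrC (x i ord0 c)); lra.
  by rewrite -subr_gt0 (_ : _ - _ = scale N k)// /radius; ring.
by rewrite /eball/= subrr enorm0.
Qed.

Let w : R := N%:R `^ (- alpha).
Let B : R := (2 * (N%:R * (2 * n%:R + 1))) `^ alpha.

Let powR_level k (r : R) : 0 < r -> r <= N%:R * radius k ->
  (2 * r) `^ alpha <= B * w ^+ k.
Proof.
move=> r0 rk; have N0 : 0 < N%:R :> R by rewrite ltr0n ltnW.
apply: (@le_trans _ _ ((2 * (N%:R * radius k)) `^ alpha)).
  have r2 : 2 * r <= 2 * (N%:R * radius k) by rewrite ler_pM2l.
  have r20 : 0 <= 2 * r by rewrite mulr_ge0// ltW.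
  apply: (ge0_ler_powR (ltW alpha0)) => //; rewrite nnegrE//.
  exact: le_trans r2.
have -> : 2 * (N%:R * radius k) = 2 * (N%:R * (2 * n%:R + 1)) * scale N k.
  by rewrite /radius !mulrA.
rewrite powRM ?mulr_ge0 ?addr_ge0 ?mulr_ge0 ?(ltW N0)//; last first.
  by rewrite ltW// scale_gt0// ltnW.
rewrite /scale -(powR_invn _ (ltW N0)) -powRrM.
have -> : w ^+ k = N%:R `^ (- alpha * k%:R).
  by rewrite powRrM powR_mulrn ?powR_ge0.
by rewrite (_ : - k%:R * alpha = - alpha * k%:R)//; ring.
Qed.

(** Each ball is sent to a level k such that its radius is between radius k and
    N * radius k, and to a cube of that level that contains its centre. *)
Lemma packing_sum_le (e : R) (Y : set nat) (x : nat -> V) (r : nat -> R)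
    (s : seq nat) : e <= 1 -> packing e E Y x r -> uniq s ->
  {in s, forall i, Y i} ->
  \sum_(i <- s) (2 * r i) `^ alpha <= B * (1 - T%:R * w)^-1.
Proof.
move=> e1 [Yr tY] us sY.
have level i : exists kd : nat * V, i \in s ->
    [/\ radius kd.1 <= r i, r i <= N%:R * radius kd.1, kd.2 \in D kd.1 &
      forall c, `|x i ord0 c - kd.2 ord0 c| <= scale N kd.1].
  have [si|] := boolP (i \in s); last by exists (0%N, 0).
  have [Ei /andP[r0 re]] := Yr _ (sY _ si).
  have [k /andP[k1 k2]] : exists k, radius k <= r i <= N%:R * radius k.
    by apply: exists_level; rewrite r0/=; lra.
  by have [d dD xd] := ED k Ei; exists (k, d).
have [g gP] := choice level.
apply: (@le_trans _ _ (\sum_(i <- s) B * w ^+ (g i).1)).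
  rewrite big_seq [leRHS]big_seq; apply: ler_sum => i si.
  have [_ k2 _ _] := gP i si; apply: powR_level => //.
  by have [_ /andP[]] := Yr _ (sY _ si).
have N0 : 0 < N%:R :> R by rewrite ltr0n ltnW.
apply: sum_level_le => //; [exact: powR_ge0|exact: powR_gt0|].
move=> l; rewrite -sD -size_filter -(size_map (fun i => (g i).2)).
apply: uniq_leq_size.
  rewrite map_inj_in_uniq ?filter_uniq// => i j.
  rewrite !mem_filter => /andP[/eqP gi si] /andP[/eqP gj sj] gij.
  have [k1 _ _ xi] := gP i si; have [_ _ _ xj] := gP j sj.
  rewrite gi in k1 xi; rewrite gj -gij in xj.
  apply: (packing_level_injective tY (sY _ si) (sY _ sj) k1 _ xi xj).
  by have [_ /andP[]] := Yr _ (sY _ sj).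
move=> d dm; have [i + ->] := mapP dm; rewrite mem_filter => /andP[/eqP gi si].
by have [_ _ + _] := gP i si; rewrite gi.
Qed.

Local Open Scope ereal_scope.

Lemma packing_pre_eps_le (e : R) : (e <= 1)%R ->
  packing_pre_eps alpha e E <= (B * (1 - T%:R * w)^-1)%:E.
Proof.
move=> e1; apply: ge_ereal_sup => _ [Y [x [r [pY ->]]]].
apply: ge_ereal_sup => _ [F [finF FY] <-].
rewrite fsbig_finite//= sumEFin lee_fin.
apply: (packing_sum_le e1 pY) => [|i]; first exact: finmap.fset_uniq.
by rewrite in_fset_set// inE => /FY.
Qed.

(** There are more packings for larger e. *)
Lemma is_cvg_packing_pre_eps (s : R) (A : set V) :
  cvg (packing_pre_eps s e A @[e --> 0^'+]).
Proof.
apply: nondecreasing_at_right_is_cvge; apply: nearW => b e e' _ _ ee'.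
apply: le_ereal_sup => _ [Y [x [r [[pY tY] ->]]]]; exists Y, x, r; split => //.
split=> // k /pY[Ak /andP[r0 re]]; split=> //; rewrite r0/= (le_trans re)//.
by rewrite ler_pM2r.
Qed.

Lemma packing_pre_eps_ge0 (s e : R) (A : set V) : 0 <= packing_pre_eps s e A.
Proof.
apply: ereal_sup_ubound; exists set0, (fun=> 0%R), (fun=> 0%R).
rewrite esum_set0; split=> //; split=> //; exact: trivIset_set0.
Qed.

Lemma packing_pre_ge0 (s : R) (A : set V) : 0 <= packing_pre s A.
Proof.
apply: lime_ge; first exact: is_cvg_packing_pre_eps.
by apply: nearW => e; exact: packing_pre_eps_ge0.
Qed.

Lemma packing_pre_set0 (s : R) : packing_pre s (set0 : set V) = 0.
Proof.
rewrite /packing_pre (_ : (fun e => _) = cst 0) ?lim_cst//.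
apply/funext => e; apply/eqP; rewrite eq_le packing_pre_eps_ge0 andbT.
apply: ge_ereal_sup => _ [Y [x [r [[pY _] ->]]]].
by rewrite esum1// => i /pY[].
Qed.

(** The covering of E by itself and empty sets; the bound of
    [packing_sum_le] does not depend on the packing. *)
Lemma packing_measure_lty : packing_measure alpha E < +oo.
Proof.
pose F (i : nat) : set V := if i is 0%N then E else set0.
have le1 : packing_measure alpha E <= \sum_(0 <= i <oo) packing_pre alpha (F i).
  apply: ereal_inf_lbound; exists F => //=.
  by apply/seteqP; split => [t Et|t [[|i] _ //]]; exists 0%N.
apply: (le_lt_trans le1).
rewrite nneseries_recl//; last by move=> k _; exact: packing_pre_ge0.
rewrite eseries0 ?adde0; last by move=> [//|i] _ _; exact: packing_pre_set0.
apply: (@le_lt_trans _ _ (B * (1 - T%:R * w)^-1)%:E); last exact: ltry.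
apply: lime_le; first exact: is_cvg_packing_pre_eps.
near=> e; apply: packing_pre_eps_le; near: e.
by apply: nbhs_right_le.
Unshelve. all: by end_near. Qed.

End packing_bound.

(** * Existence of the function *)

(** With b = 2n/p, the integer T is the successor of the integral part of N^b.
    It is smaller than N^alpha because N^(alpha - b) >= 2 and N^b > 1. *)
Lemma exists_parameters (R : realType) (n : nat) (alpha p : R) : 0 < p ->
  (0 < n)%N -> 2 * n%:R / p < alpha ->
  exists N T : nat, [/\ (1 < N)%N, (0 < T)%N,
    step_ratio n N T p < 1 & T%:R * N%:R `^ (- alpha) < 1].
Proof.
rewrite -(ltr0n R) => p0 n0; set b := 2 * n%:R / p => ba.
have b0 : 0 < b by rewrite divr_gt0// mulr_gt0.
have c0 : 0 < alpha - b by rewrite subr_gt0.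
pose N := (Num.truncn (2 `^ (alpha - b)^-1 : R)).+2.
pose T := (Num.truncn (N%:R `^ b : R)).+1.
have N0 : 0 < N%:R :> R by rewrite ltr0n.
have NbT : N%:R `^ b < T%:R :> R by exact: truncnS_gt.
have T1 : T%:R <= N%:R `^ b + 1 :> R.
  by rewrite -natr1 lerD2r truncn_le powR_ge0.
have Nc : 2 <= N%:R `^ (alpha - b) :> R.
  have : 2 `^ (alpha - b)^-1 <= N%:R :> R.
    by rewrite ltW// (lt_trans (truncnS_gt _))// ltr_nat.
  move=> /(ge0_ler_powR (ltW c0)); rewrite !nnegrE powR_ge0 ltW// => /(_ isT isT).
  by rewrite -powRrM mulVf ?gt_eqF// powRr1.
have Nb : 1 < N%:R `^ b :> R.
  by have := gt0_ltr_powR b0 ler01 (ler0n R N) (_ : 1 < N%:R); rewrite powR1 ltr1n; exact.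
exists N, T; split=> //.
- rewrite /step_ratio powRN ltr_pdivrMr ?powR_gt0 ?ltr0n// mul1r.
  have -> : N%:R ^+ n = (N%:R `^ b) `^ (p / 2) :> R.
    rewrite -powRrM (_ : b * _ = n%:R) ?powR_mulrn// /b.
    by field; rewrite gt_eqF.
  by apply: gt0_ltr_powR; rewrite ?divr_gt0// nnegrE ?powR_ge0.
- rewrite powRN ltr_pdivrMr ?powR_gt0// mul1r (le_lt_trans T1)//.
  rewrite -(subrK b alpha) addrC powRD; last by rewrite (gt_eqF N0) implybT.
  nra.
Qed.

Theorem mainTheorem2 (R : realType) (n : nat) (alpha p : R) :
  (1 <= n)%N -> 0 < alpha < n%:R -> 2 * n%:R / alpha < p ->
  exists (E : set 'rV[R]_n) (f : 'rV[R]_n -> R[i]),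
    [/\ (packing_measure alpha E < +oo)%E,
        memLp p f,
        ~ {ae lebesgue_rV n, forall x, f x = 0} &
        dist_supp (fourier_dist (distribution_of f)) `<=` E].
Proof.
move=> n1 /andP[a0 an] ap.
have n0 : 0 < n%:R :> R by rewrite ltr0n.
have p0 : 0 < p by rewrite (lt_trans _ ap)// divr_gt0// mulr_gt0.
move: ap; rewrite ltr_pdivrMr// => ap.
have p1 : 1 <= p by nra.
have [|N [T [N1 T0 ratio1 T_small]]] := @exists_parameters R n alpha p p0 n1.
  by rewrite ltr_pdivrMr// [alpha * p]mulrC.
have [D [D0 sD Dnested Dincr DLp]] := refine_sequence n N1 T0 p1.
exists (limit_set N D), (limit_fun N T D); split.
- by apply: (packing_measure_lty N1 T0 a0 T_small sD) => k t; exact.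
- exact: (memLp_limit_fun N1 T0 p1 D0 sD Dincr DLp ratio1).
- exact: (limit_fun_neq0 N1 T0 D0 sD Dnested Dincr).
- exact: (dist_supp_limit_fun N1 T0 sD Dnested Dincr).
Qed.
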